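(* Let $p\ge1$ be an integer. The Polish groups $\mathrm{PO}_{\mathbf{C}}(p,\infty)$, $\mathrm{PO}_{\mathbf{H}}(p,\infty)$ and $\mathrm{PO}^o_{\mathbf{R}}(p,\infty)$ are topologically simple.
   Context: Here $\infty=\aleph_0$. $\mathbf{H}$ denotes the quaternions (scalars act on the right). For $\mathbf{K}\in\{\mathbf{R},\mathbf{C},\mathbf{H}\}$ let $\mathcal{H}$ be a $\mathbf{K}$-Hilbert space with a strongly non-degenerate quadratic (Hermitian) form $Q$ of signature $(p,\infty)$: concretely, $Q(x)=\sum_{i\le p}\overline{x_i}x_i-\sum_{i>p}\overline{x_i}x_i$ in a countably infinite Hilbert basis; $\varphi$ is its polarization. $\mathrm{O}_{\mathbf{K}}(p,\infty)$ is the group of bounded invertible $\mathbf{K}$-linear operators preserving $Q$ and $\mathrm{PO}_{\mathbf{K}}(p,\infty)$ is its quotient by its center $\{\lambda\,\mathrm{Id}:\lambda\in \mathcal{Z}(\mathbf{K}),|\lambda|=1\}$. $\mathcal{X}_{\mathbf{K}}(p,\infty)$ is the set of $p$-dimensional $\mathbf{K}$-subspaces $V\le\mathcal{H}$ with $Q|_V$ positive definite, with its invariant symmetric space metric: up to normalization $d(V,W)=(\sum_i\lambda_i^2)^{1/2}$, where there are $\varphi$-orthonormal bases $(v_i)$ of $V$ and $(w_i)$ of $W$ with $\varphi(v_i,w_j)=\delta_{ij}\cosh\lambda_i$, $\lambda_i\ge 0$. $\mathrm{PO}_{\mathbf{K}}(p,\infty)$ acts faithfully on it by isometries and carries the topology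 of pointwise convergence on $\mathcal{X}_{\mathbf{K}}(p,\infty)$. Real case: for $P\in\mathcal{X}_{\mathbf{R}}(p,\infty)$ with $Q$-orthogonal projection $\pi_P\colon\mathcal{H}\to P$, the sign of $\det((\pi_P\circ g)|_P)$ defines a homomorphism $\mathrm{or}\colon\mathrm{O}_{\mathbf{R}}(p,\infty)\to\{\pm1\}$ independent of $P$. Its kernel $\mathrm{O}^o_{\mathbf{R}}(p,\infty)$ is the orthochronous group and $\mathrm{PO}^o_{\mathbf{R}}(p,\infty)$ is the image of this kernel in $\mathrm{PO}_{\mathbf{R}}(p,\infty)$. A topological group is topologically simple if any non-trivial normal subgroup is dense. *)

(* Defs.v *)
From HB Require Import structures.
From mathcomp Require Import all_boot all_order all_algebra.
From mathcomp Require Import complex.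
From mathcomp Require Import all_classical all_reals all_analysis.
From mathcomp Require Import ring.

Set Implicit Arguments.
Unset Strict Implicit.
Unset Printing Implicit Defensive.

Import Order.TTheory GRing.Theory Num.Theory.
Import numFieldNormedType.Exports.

Local Open Scope classical_set_scope.
Local Open Scope ring_scope.
Local Open Scope quotient_scope.

Declare Scope hspace_scope.
Delimit Scope hspace_scope with HS.
Local Open Scope hspace_scope.

#[short(type="preTopologicalGroupType")]
HB.structure Definition PreTopologicalGroup :=
  {G of Group G & Topological G}.

Section TopologicallySimple.
Variable G : preTopologicalGroupType.
Local Open Scope group_scope.

Definition subgroup (A : set G) :=
  A 1 /\ forall x y, A x -> A y -> A (x * y^-1).

Definition normal_subgroup (N A : set G) :=
  [/\ subgroup N, N `<=` A & forall x y, A x -> N y -> N (y ^ x)].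

(* Topological simplicity of the subgroup A with the induced topology. *)
Definition topologically_simple (A : set G) :=
  forall N : set G, normal_subgroup N A -> N <> [set 1] -> A `<=` closure N.

End TopologicallySimple.

Record quaternion (R : Type) := Quat { qre : R; qi : R; qj : R; qk : R }.

Section Quaternions.
Variable R : comNzRingType.
Implicit Types x y z : quaternion R.

Definition quat_encode x := (qre x, qi x, qj x, qk x).
Definition quat_decode (t : R * R * R * R) : quaternion R :=
  let: (a, b, c, d) := t in Quat a b c d.

Lemma quat_encodeK : cancel quat_encode quat_decode.
Proof. by case. Qed.

HB.instance Definition _ := Choice.copy (quaternion R) (can_type quat_encodeK).

Definition addq x y :=
  Quat (qre x + qre y) (qi x + qi y) (qj x + qj y) (qk x + qk y).
Definition oppq x := Quat (- qre x) (- qi x) (- qj x) (- qk x).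

Lemma addqA : associative addq.
Proof. by case=> ? ? ? ? [? ? ? ?] [? ? ? ?]; congr Quat; exact: addrA. Qed.
Lemma addqC : commutative addq.
Proof. by case=> ? ? ? ? [? ? ? ?]; congr Quat; exact: addrC. Qed.
Lemma add0q : left_id (Quat 0 0 0 0) addq.
Proof. by case=> ? ? ? ?; congr Quat; exact: add0r. Qed.
Lemma addNq : left_inverse (Quat 0 0 0 0) oppq addq.
Proof. by case=> ? ? ? ?; congr Quat; exact: addNr. Qed.

HB.instance Definition _ :=
  GRing.isZmodule.Build (quaternion R) addqA addqC add0q addNq.

Definition mulq x y :=
  let: Quat a b c d := x in let: Quat a' b' c' d' := y in
  Quat (a * a' - b * b' - c * c' - d * d')
       (a * b' + b * a' + c * d' - d * c')
       (a * c' - b * d' + c * a' + d * b')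
       (a * d' + b * c' - c * b' + d * a').

Lemma mulqA : associative mulq.
Proof. by case=> ? ? ? ? [? ? ? ?] [? ? ? ?]; congr Quat => /=; ring. Qed.
Lemma mul1q : left_id (Quat 1 0 0 0) mulq.
Proof. by case=> ? ? ? ?; congr Quat => /=; ring. Qed.
Lemma mulq1 : right_id (Quat 1 0 0 0) mulq.
Proof. by case=> ? ? ? ?; congr Quat => /=; ring. Qed.
Lemma mulqDl : left_distributive mulq addq.
Proof. by case=> ? ? ? ? [? ? ? ?] [? ? ? ?]; congr Quat => /=; ring. Qed.
Lemma mulqDr : right_distributive mulq addq.
Proof. by case=> ? ? ? ? [? ? ? ?] [? ? ? ?]; congr Quat => /=; ring. Qed.
Lemma oneq_neq0 : Quat 1 0 0 0 != Quat 0 0 0 0 :> quaternion R.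
Proof. by apply/eqP => -[/eqP]; rewrite oner_eq0. Qed.

HB.instance Definition _ := GRing.Zmodule_isNzRing.Build (quaternion R)
  mulqA mul1q mulq1 mulqDl mulqDr oneq_neq0.

Definition conjq x := Quat (qre x) (- qi x) (- qj x) (- qk x).

Lemma conjqK : involutive conjq.
Proof. by case=> ? ? ? ?; rewrite /conjq /= !opprK. Qed.
Lemma conjqD x y : conjq (x + y) = conjq x + conjq y.
Proof. by case: x y => [? ? ? ?] [? ? ? ?]; congr Quat; exact: opprD. Qed.
Lemma conjqM x y : conjq (x * y) = conjq y * conjq x.
Proof.
by case: x y => [a b c d] [a' b' c' d']; rewrite /conjq; congr Quat => /=; ring.
Qed.

End Quaternions.

(* The scalars: a ring K with an involution, its real part, and the inclusion
   of R. Only the three instances below matter. *)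
Record scalars (R : realType) := Scalars {
  scalar :> nzRingType;
  sconj : scalar -> scalar;
  sre : scalar -> R;
  of_real : R -> scalar;
  sconjK : involutive sconj;
  sconjD : forall a b, sconj (a + b) = sconj a + sconj b;
  sconjM : forall a b, sconj (a * b) = sconj b * sconj a
}.

Section ThreeScalars.
Variable R : realType.

Definition realScalars : scalars R :=
  @Scalars R R id id id (fun=> erefl) (fun _ _ => erefl) (@mulrC R).

Lemma conjcMr (a b : R[i]) : conjc (a * b) = conjc b * conjc a.
Proof. by rewrite rmorphM mulrC. Qed.

Definition complexScalars : scalars R :=
  @Scalars R R[i] (@conjc R) (@complex.Re R) (fun r => Complex r 0)
    (@conjcK R) (fun a b => rmorphD _ a b) conjcMr.

Definition quaternionScalars : scalars R :=
  @Scalars R (quaternion R) (@conjq R) (@qre R) (fun r => Quat r 0 0 0)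
    (@conjqK R) (@conjqD R) (@conjqM R).

End ThreeScalars.

Section Scalars.
Variables (R : realType) (K : scalars R).

Definition sabs2 (a : K) : R := sre (sconj a * a).

Definition central (a : K) := forall b : K, a * b = b * a.

(* Modulus one is expressed as conj a * a = 1. *)
Definition central_unit (a : K) := central a /\ sconj a * a = 1.

Lemma sconj1 : sconj (1 : K) = 1.
Proof. by rewrite -[RHS]sconjK -[X in _ = sconj X]mul1r sconjM sconjK mul1r. Qed.

Lemma central_unit1 : central_unit 1.
Proof. by split=> [b|]; rewrite ?sconj1 mulr1 ?mul1r. Qed.

Lemma central_unitM a b : central_unit a -> central_unit b ->
  central_unit (a * b).
Proof.
move=> [ca ua] [cb ub]; split=> [c|].
  by rewrite -mulrA cb mulrA ca mulrA.
by rewrite sconjM -mulrA [_ * (a * b)]mulrA ua mul1r.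
Qed.

Lemma central_unit_conj a : central_unit a -> central_unit (sconj a).
Proof.
move=> [ca ua]; split=> [b|]; last by rewrite sconjK ca.
by rewrite -[b]sconjK -!sconjM ca.
Qed.

Lemma central_unit_conjr a : central_unit a -> a * sconj a = 1.
Proof. by move=> [ca ua]; rewrite ca. Qed.

End Scalars.

(* Scalars act on the right: a right K-module is a left module over the
   converse ring K^c. *)
Definition rscale (R : realType) (K : scalars R) (V : lmodType K^c)
  (x : V) (a : K) : V := (a : K^c) *: x.
Notation "x *> a" := (rscale x a)
  (at level 40, left associativity) : hspace_scope.

Record hilbertSpace (R : realType) (K : scalars R) := HilbertSpace {
  hcarrier :> lmodType K^c;
  ip : hcarrier -> hcarrier -> K;
  ipDr : forall x y z, ip x (y + z) = ip x y + ip x z;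
  ipZr : forall x y (a : K), ip x (y *> a) = ip x y * a;
  ip_conj : forall x y, ip y x = sconj (ip x y);
  ip_gt0 : forall x, x != 0 -> 0 < sre (ip x x);
  ip_complete : forall u : nat -> hcarrier,
    (forall eps : R, 0 < eps -> exists N, forall m n,
       (N <= m)%N -> (N <= n)%N ->
       Num.sqrt (sre (ip (u m - u n) (u m - u n))) < eps) ->
    exists l, (fun n => Num.sqrt (sre (ip (u n - l) (u n - l)))) @ \oo --> 0
}.

Section HilbertBasis.
Variables (R : realType) (K : scalars R) (H : hilbertSpace K).

Definition hnorm (x : H) : R := Num.sqrt (sre (ip x x)).

Definition hilbert_basis (e : nat -> H) :=
  (forall i j, ip (e i) (e j) = (i == j)%:R) /\
  (forall x, (fun n => hnorm (x - \sum_(i < n) e i *> ip (e i) x)) @ \oo --> 0).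

Definition bounded_op (f : H -> H) :=
  exists C : R, forall x, hnorm (f x) <= C * hnorm x.

End HilbertBasis.

(* A Hilbert space with a Hermitian form phi whose quadratic form is, in the
   coordinates x_i = <e_i, x> of some countably infinite Hilbert basis,
   Q(x) = \sum_(i < p) |x_i|^2 - \sum_(i >= p) |x_i|^2. *)
Record qspace (R : realType) (K : scalars R) (p : nat) := QSpace {
  qhilbert :> hilbertSpace K;
  phi : qhilbert -> qhilbert -> K;
  phiDr : forall x y z, phi x (y + z) = phi x y + phi x z;
  phiZr : forall x y (a : K), phi x (y *> a) = phi x y * a;
  phi_conj : forall x y, phi y x = sconj (phi x y);
  phi_signature : exists e : nat -> qhilbert, hilbert_basis e /\
    forall x, (fun n => \sum_(i < n)
                 (if (i < p)%N then sabs2 (ip (e i) x)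
                  else - sabs2 (ip (e i) x))) @ \oo --> sre (phi x x)
}.

Section QSpace.
Variables (R : realType) (K : scalars R) (p : nat) (H : qspace K p).

Definition Q (x : H) : R := sre (phi x x).

Definition is_orth (g : H -> H) :=
  [/\ linear g, bounded_op g,
      exists h : H -> H, [/\ cancel g h, cancel h g & bounded_op h]
    & forall x, Q (g x) = Q x].

Record orth := Orth { orth_fun :> H -> H; orthP : is_orth orth_fun }.

HB.instance Definition _ := gen_eqMixin orth.
HB.instance Definition _ := gen_choiceMixin orth.

Lemma orth_ext (g h : orth) : (forall x, g x = h x) -> g = h.
Proof.
case: g h => [g gP] [h hP] /= /funext gh; case: _ / gh in hP *.
by congr Orth; exact: Prop_irrelevance.
Qed.

Lemma orthD (g : orth) x y : g (x + y) = g x + g y.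
Proof. by have [gl _ _ _] := orthP g; have := gl 1 x y; rewrite !scale1r. Qed.

Lemma orth0 (g : orth) : g 0 = 0.
Proof. by apply: (addrI (g 0)); rewrite -orthD !addr0. Qed.

Lemma orthZ (g : orth) x a : g (x *> a) = g x *> a.
Proof.
have [gl _ _ _] := orthP g; rewrite /rscale.
by rewrite -[X in g X]addr0 gl orth0 addr0.
Qed.

Lemma orth_sum (g : orth) n (F : 'I_n -> H) :
  g (\sum_(i < n) F i) = \sum_(i < n) g (F i).
Proof. by apply: (big_morph g (orthD g)); exact: orth0. Qed.

Lemma bounded_op_comp (f g : H -> H) :
  bounded_op f -> bounded_op g -> bounded_op (f \o g).
Proof.
move=> [C fC] [D gD]; exists (`|C| * D) => x /=.
apply: (le_trans (fC _)); rewrite -mulrA.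
apply: (@le_trans _ _ (`|C| * hnorm (g x))).
  by rewrite ler_wpM2r ?sqrtr_ge0 ?ler_norm.
by rewrite ler_wpM2l.
Qed.

Lemma is_orth_id : is_orth idfun.
Proof.
have bid : bounded_op (idfun : H -> H) by exists 1 => x; rewrite mul1r.
by split=> //; exists idfun; split.
Qed.

Lemma is_orth_comp (g h : orth) : is_orth (g \o h).
Proof.
have [gl gb [g' [gK g'K g'b]] gQ] := orthP g.
have [hl hb [h' [hK h'K h'b]] hQ] := orthP h.
split; [by move=> a x y /=; rewrite hl gl | exact: bounded_op_comp | |
        by move=> x /=; rewrite gQ hQ].
exists (h' \o g'); split; [exact: can_comp | exact: can_comp |].
exact: bounded_op_comp.
Qed.

Definition orth_inv_fun (g : orth) : H -> H :=
  projT1 (cid (let: And4 _ _ e _ := orthP g in e)).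

Lemma orth_inv_funP (g : orth) :
  [/\ cancel g (orth_inv_fun g), cancel (orth_inv_fun g) g
    & bounded_op (orth_inv_fun g)].
Proof. exact: (projT2 (cid (let: And4 _ _ e _ := orthP g in e))). Qed.

Lemma is_orth_inv (g : orth) : is_orth (orth_inv_fun g).
Proof.
have [gK g'K g'b] := orth_inv_funP g; have [gl gb _ gQ] := orthP g.
split=> //; last by move=> x; rewrite -gQ g'K.
  by move=> a x y; apply: (can_inj gK); rewrite gl !g'K.
by exists g; split.
Qed.

Definition orth_mul (g h : orth) := Orth (is_orth_comp g h).
Definition orth_inv (g : orth) := Orth (is_orth_inv g).

Lemma orth_mulA : associative orth_mul.
Proof. by move=> f g h; apply: orth_ext. Qed.
Lemma orth_mul1g : left_id (Orth is_orth_id) orth_mul.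
Proof. by move=> g; apply: orth_ext. Qed.
Lemma orth_mulg1 : right_id (Orth is_orth_id) orth_mul.
Proof. by move=> g; apply: orth_ext. Qed.
Lemma orth_mulVg : left_inverse (Orth is_orth_id) orth_inv orth_mul.
Proof. by move=> g; apply: orth_ext; have [] := orth_inv_funP g. Qed.
Lemma orth_mulgV : right_inverse (Orth is_orth_id) orth_inv orth_mul.
Proof. by move=> g; apply: orth_ext; have [] := orth_inv_funP g. Qed.

HB.instance Definition _ := isGroup.Build orth
  orth_mulA orth_mul1g orth_mulg1 orth_mulVg orth_mulgV.

(* Congruence modulo the group of the central scalars of modulus one. *)
Definition proj_eq (g h : orth) : bool :=
  `[< exists a : K, central_unit a /\ forall x, g x = h x *> a >].

Lemma rscale1 (x : H) : x *> (1 : K) = x.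
Proof. exact: scale1r. Qed.

Lemma rscaleA (x : H) (a b : K) : x *> a *> b = x *> (a * b).
Proof. by rewrite /rscale scalerA. Qed.

Lemma proj_eq_refl : reflexive proj_eq.
Proof.
by move=> g; apply/asboolP; exists 1; split=> [|x];
  [exact: central_unit1 | rewrite rscale1].
Qed.

Lemma proj_eq_symW g h : proj_eq g h -> proj_eq h g.
Proof.
move=> /asboolP[a [ua gh]]; apply/asboolP; exists (sconj a).
split=> [|x]; first exact: central_unit_conj.
by rewrite gh rscaleA central_unit_conjr ?rscale1.
Qed.

Lemma proj_eq_sym : symmetric proj_eq.
Proof. by move=> g h; apply/idP/idP; exact: proj_eq_symW. Qed.

Lemma proj_eq_trans : transitive proj_eq.
Proof.
move=> h g k /asboolP[a [ua gh]] /asboolP[b [ub hk]]; apply/asboolP.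
exists (b * a); split=> [|x]; first exact: central_unitM.
by rewrite gh hk rscaleA.
Qed.

Canonical proj_equiv :=
  EquivRel proj_eq proj_eq_refl proj_eq_sym proj_eq_trans.

Definition PO := {eq_quot proj_equiv}.
HB.instance Definition _ := Choice.on PO.
HB.instance Definition _ := EqQuotient.on PO.

Local Open Scope group_scope.

Definition PO_mul (x y : PO) : PO := \pi_PO (repr x * repr y).
Definition PO_inv (x : PO) : PO := \pi_PO (repr x)^-1.

Lemma PO_eqP (g h : orth) : reflect
  (exists a : K, central_unit a /\ forall x, g x = (h x *> a)%HS)
  (\pi_PO g == \pi_PO h).
Proof. by rewrite eqmodE; exact: asboolP. Qed.

Lemma PO_mulE (g h : orth) : PO_mul (\pi_PO g) (\pi_PO h) = \pi_PO (g * h).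
Proof.
rewrite /PO_mul; apply/eqP/PO_eqP.
have /eqP/PO_eqP[a [ua ga]] := reprK (\pi_PO g).
have /eqP/PO_eqP[b [ub hb]] := reprK (\pi_PO h).
exists (b * a)%R; split=> [|x]; first exact: central_unitM.
rewrite -[LHS]/(repr (\pi_PO g) (repr (\pi_PO h) x)).
by rewrite ga hb orthZ rscaleA.
Qed.

Lemma PO_invE (g : orth) : PO_inv (\pi_PO g) = \pi_PO g^-1.
Proof.
rewrite /PO_inv; apply/eqP/PO_eqP.
have /eqP/PO_eqP[a [ua ga]] := reprK (\pi_PO g).
set r := repr _ in ga *.
exists (sconj a); split=> [|x]; first exact: central_unit_conj.
have [rK r'K _] := orth_inv_funP r.
have [gK g'K _] := orth_inv_funP g.
apply: (can_inj rK); rewrite -[X in r X]/(orth_inv_fun r x) r'K.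
rewrite orthZ ga rscaleA central_unit_conjr // rscale1.
by rewrite -[X in g X]/(orth_inv_fun g x) g'K.
Qed.

Lemma PO_mulA : associative PO_mul.
Proof.
elim/quotW=> x; elim/quotW=> y; elim/quotW=> z.
by rewrite (PO_mulE x y) (PO_mulE y z) !PO_mulE mulgA.
Qed.
Lemma PO_mul1g : left_id (\pi_PO 1) PO_mul.
Proof. by elim/quotW=> x; rewrite PO_mulE mul1g. Qed.
Lemma PO_mulg1 : right_id (\pi_PO 1) PO_mul.
Proof. by elim/quotW=> x; rewrite PO_mulE mulg1. Qed.
Lemma PO_mulVg : left_inverse (\pi_PO 1) PO_inv PO_mul.
Proof. by elim/quotW=> x; rewrite PO_invE PO_mulE mulVg. Qed.
Lemma PO_mulgV : right_inverse (\pi_PO 1) PO_inv PO_mul.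
Proof. by elim/quotW=> x; rewrite PO_invE PO_mulE mulgV. Qed.

HB.instance Definition _ := isGroup.Build PO
  PO_mulA PO_mul1g PO_mulg1 PO_mulVg PO_mulgV.

Local Close Scope group_scope.

Definition is_basis (b : 'I_p -> H) (V : set H) :=
  (forall c : 'I_p -> K,
     \sum_(i < p) b i *> c i = 0 -> forall i, c i = 0) /\
  V = [set x | exists c : 'I_p -> K, x = \sum_(i < p) b i *> c i].

Definition is_positive (V : set H) := forall x, V x -> x != 0 -> 0 < Q x.

Record symspace := SymSpace {
  symspace_set :> set H;
  symspaceP : (exists b, is_basis b symspace_set) /\ is_positive symspace_set
}.

HB.instance Definition _ := gen_eqMixin symspace.
HB.instance Definition _ := gen_choiceMixin symspace.

Definition phi_orthonormal (v : 'I_p -> H) :=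
  forall i j, phi (v i) (v j) = (i == j)%:R.

Definition coshR (x : R) : R := (expR x + expR (- x)) / 2.

Definition is_dist (V W : symspace) (r : R) :=
  exists (v w : 'I_p -> H) (lam : 'I_p -> R),
    [/\ is_basis v V /\ phi_orthonormal v, is_basis w W /\ phi_orthonormal w,
        forall i, 0 <= lam i,
        forall i j, phi (v i) (w j) =
                    if i == j then of_real K (coshR (lam i)) else 0
      & r = Num.sqrt (\sum_(i < p) lam i ^+ 2)].

(* Such an r exists and is unique; 0 is a dummy value. *)
Definition dist (V W : symspace) : R := xget 0 [set r | is_dist V W r].

Definition dball (V : symspace) (r : R) : set symspace :=
  [set W | dist V W < r].

(* The metric topology: the open balls of a metric space form a base. *)
HB.instance Definition _ := isSubBaseTopological.Build symspace
  [set B : set symspace | exists V r, B = dball V r] id.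

Lemma act_subproof (g : orth) (V : symspace) :
  (exists b, is_basis b (g @` V)) /\ is_positive (g @` V).
Proof.
have [[b [bfree bV]] Vpos] := symspaceP V.
have [gK g'K _] := orth_inv_funP g; have [_ _ _ gQ] := orthP g.
have gsum c : \sum_(i < p) g (b i) *> c i = g (\sum_(i < p) b i *> c i).
  by rewrite orth_sum; apply: eq_bigr => i _; rewrite orthZ.
split; last first.
  move=> _ [x Vx <-] gx0; rewrite gQ; apply: Vpos => //.
  by apply: contra_neq gx0 => ->; rewrite orth0.
exists (g \o b); split=> [c /=|].
  by rewrite gsum -[RHS in _ = RHS -> _](orth0 g) => /(can_inj gK)/bfree.
rewrite bV; apply/seteqP; split=> [_ [_ [c ->] <-]|_ [c ->]] /=.
  by exists c; rewrite gsum.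
by exists (\sum_(i < p) b i *> c i); [exists c | rewrite gsum].
Qed.

Definition orth_act (g : orth) (V : symspace) : symspace :=
  SymSpace (act_subproof g V).

(* Independent of the representative: central scalars preserve subspaces. *)
Definition PO_act (x : PO) : {ptws symspace -> symspace} :=
  fun V => orth_act (repr x) V.

HB.instance Definition _ := Topological.copy PO (initial_topology PO_act).

End QSpace.

Section Orthochronous.
Variables (R : realType) (p : nat) (H : qspace (realScalars R) p).

(* The Q-orthogonal projection onto V. *)
Definition qproj (V : set H) (x : H) : H :=
  xget 0 [set y | V y /\ forall z, V z -> phi z (x - y) = 0].

Definition coords (b : 'I_p -> H) (x : H) : 'I_p -> R :=
  xget (fun=> 0)
    [set c : 'I_p -> R | x = \sum_(i < p) rscale (K := realScalars R) (b i) (c i)].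

(* The matrix, in the basis b of V, of the endomorphism x |-> qproj V (g x). *)
Definition compression_mx (g : orth H) (V : set H) (b : 'I_p -> H) : 'M[R]_p :=
  \matrix_(i, j) coords b (qproj V (g (b j))) i.

(* The sign below depends neither on V nor on b. *)
Definition orthochronous : set (orth H) :=
  [set g | forall (V : symspace H) (b : 'I_p -> H), is_basis b V ->
     Num.sg (\det (compression_mx g V b)) = 1].

Definition POo : set (PO H) := [set \pi_(PO H) g | g in orthochronous].

End Orthochronous.

Arguments orthochronous {R p} H.
Arguments POo {R p} H.

(* Main.v *)
Require Import Defs.
From mathcomp Require Import all_boot all_order all_algebra.
From mathcomp Require Import complex.
From mathcomp Require Import all_classical all_reals all_analysis.
From mathcomp Require Import ring lra.

(** Let [N] be a nontrivial normal subgroup of one of the three groups, and lift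
it to isometries. Density is obtained in a strong form: for every [g] in the
group and every finite set [s] of vectors, some element of [N] agrees with [g]
on [s] exactly. Agreement on a basis of [V] gives the same image of [V], so that
such elements converge to [g] at every point of the symmetric space, whatever
the metric is ([orth_limit_closure]).

The building blocks are the quasi-reflections [z - v *> (m * phi v z)], which
include the reflections, and only those with [Q v < 0] are used. They suffice
because a difference [x - y] of vectors of equal square, when it is negative, is
the vector of a quasi-reflection moving [x] to [y] and fixing the orthogonal of
[x - y] ([negative_qrefl_move]); and there is always room, since the orthogonal
of a finite set contains vectors of any given negative square
([negative_orth]).

Every negative quasi-reflection is a limit of elements of [N] for agreement on
finite sets ([negative_qrefl_limit]). A nonscalar [n] in [N] moves the line of
some negative vector [v]. The commutator of [n] with the quasi-reflection t_v is
t_u / t_v in [N], where u = n v. There is a vector [w] orthogonal to [v], of the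
same square and with the same product with [u] ([orthogonal_twin]); the
quasi-reflection exchanging [v] and [w] fixes [u], so t_u / t_w is in [N] too,
hence t_v / t_w. By transitivity on orthogonal pairs, the same holds for every
[v], with [w] moreover orthogonal to a prescribed finite set [s], on which
t_v / t_w then agrees with t_v.

Every [g] of the group agrees on every finite set with a product of negative
quasi-reflections ([subgroup_in_limit]). First the positive part [e 0], ...,
[e p.-1] of the Hilbert basis is brought back to its place, one vector at a
time: two vectors [x] and [y] of square 1 with Re [phi x y] > -1 are exchanged
by two negative quasi-reflections, and otherwise one passes through a vector [u]
with Re [phi x u] = 0. Such a [u] is [x] times an imaginary unit over the
complex numbers and the quaternions. Over the reals it exists as long as two
positive directions remain, and for the last one the condition on [phi x y]
holds because [g] is orthochronous. Once the positive part is fixed, the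
remaining differences lie in its orthogonal, which is negative definite.

In the real case one also needs that the orthochronous isometries form a group
containing the negative reflections. The sign of the Gram determinant of two
positive frames is multiplicative ([sign_cocycle]), because the components of a
positive frame in the orthogonal of another one can be shrunk to zero without
losing positivity, hence without a sign change. *)

Set Implicit Arguments.
Unset Strict Implicit.
Unset Printing Implicit Defensive.

Import Order.TTheory GRing.Theory Num.Theory.
Import numFieldNormedType.Exports.

Local Open Scope classical_set_scope.
Local Open Scope ring_scope.
Local Open Scope hspace_scope.
Local Open Scope quotient_scope.

(** * The three division rings *)

(** What the real numbers, the complex numbers and the quaternions have in
common: that the trace [a + sconj a] and the squared modulus are real, hence
central, does the work of commutativity. *)
Record scalar_laws (R : realType) (K : scalars R) : Prop := ScalarLaws {
  sreD : forall a b : K, sre (a + b) = sre a + sre b;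
  sreC : forall a b : K, sre (a * b) = sre (b * a);
  sre_real : forall r, sre (of_real K r) = r;
  of_realD : forall r s, of_real K (r + s) = of_real K r + of_real K s;
  of_realM : forall r s, of_real K (r * s) = of_real K r * of_real K s;
  of_real1 : of_real K 1 = 1;
  of_realC : forall r (a : K), of_real K r * a = a * of_real K r;
  addsJ : forall a : K, a + sconj a = of_real K (2 * sre a);
  mulJs : forall a : K, sconj a * a = of_real K (sabs2 a);
  sabs2_gt0 : forall a : K, a != 0 -> 0 < sabs2 a
}.

Lemma real_scalar_laws (R : realType) : scalar_laws (realScalars R).
Proof.
split=> //=; rewrite /sabs2 /=.
- by move=> a b; rewrite mulrC.
- by move=> r a; rewrite mulrC.
- by move=> a; ring.
- by move=> a a0; rewrite -expr2 exprn_even_gt0.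
Qed.

Lemma complex_scalar_laws (R : realType) : scalar_laws (complexScalars R).
Proof.
split=> //=; rewrite /sabs2 /=.
- by move=> [a b] [c d].
- by move=> [a b] [c d] /=; ring.
- by move=> r s; congr Complex => /=; ring.
- by move=> r s; congr Complex => /=; ring.
- by move=> r a; rewrite mulrC.
- by move=> [a b]; congr Complex => /=; ring.
- by move=> [a b]; congr Complex => /=; ring.
- move=> [a b]; rewrite eq_complex /= negb_and => ab0.
  rewrite mulNr opprK -!expr2; case/orP: ab0 => h.
    by rewrite ltr_pwDl ?sqr_ge0 // exprn_even_gt0.
  by rewrite ltr_wpDl ?sqr_ge0 // exprn_even_gt0.
Qed.

Lemma quaternion_scalar_laws (R : realType) :
  scalar_laws (quaternionScalars R).
Proof.
split=> //=; rewrite /sabs2 /=.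
- by move=> [? ? ? ?] [? ? ? ?] /=; ring.
- by move=> r s; congr Quat => /=; ring.
- by move=> r s; congr Quat => /=; ring.
- by move=> r [? ? ? ?]; congr Quat => /=; ring.
- by move=> [? ? ? ?]; congr Quat => /=; ring.
- by move=> [? ? ? ?]; congr Quat => /=; ring.
- move=> [a b c d] h /=.
  have -> : a * a - (- b) * b - (- c) * c - (- d) * d =
     a ^+ 2 + b ^+ 2 + c ^+ 2 + d ^+ 2 by ring.
  rewrite lt_neqAle !addr_ge0 ?sqr_ge0 // andbT eq_sym.
  apply: contra h; rewrite !paddr_eq0 ?addr_ge0 ?sqr_ge0 // !sqrf_eq0.
  by case/andP=> /andP[/andP[/eqP-> /eqP->] /eqP->] /eqP->.
Qed.

Section Scalars.
Variables (R : realType) (K : scalars R).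
Hypothesis hK : scalar_laws K.
Implicit Types a b : K.

Lemma of_real0 : of_real K 0 = 0.
Proof. by apply: (addrI (of_real K 0)); rewrite -(of_realD hK) !addr0. Qed.

Lemma of_realN r : of_real K (- r) = - of_real K r.
Proof.
by apply: (addrI (of_real K r)); rewrite -(of_realD hK) !subrr of_real0.
Qed.

Lemma sre0 : sre (0 : K) = 0.
Proof. by rewrite -of_real0 (sre_real hK). Qed.

Lemma sreN a : sre (- a) = - sre a.
Proof. by apply: (addrI (sre a)); rewrite -(sreD hK) !subrr sre0. Qed.

Lemma sreB a b : sre (a - b) = sre a - sre b.
Proof. by rewrite (sreD hK) sreN. Qed.

Lemma sre_sum n (F : 'I_n -> K) :
  sre (\sum_(i < n) F i) = \sum_(i < n) sre (F i).
Proof. by apply: (big_morph (@sre _ K) (sreD hK)); exact: sre0. Qed.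

Lemma sconj0 : sconj (0 : K) = 0.
Proof. by apply: (addrI (sconj (0 : K))); rewrite -sconjD !addr0. Qed.

Lemma sconjN a : sconj (- a) = - sconj a.
Proof. by apply: (addrI (sconj a)); rewrite -sconjD !subrr sconj0. Qed.

Lemma sre_conj a : sre (sconj a) = sre a.
Proof.
have := addsJ hK (sconj a); rewrite sconjK addrC (addsJ hK).
move=> /(congr1 (@sre _ K)).
by rewrite !(sre_real hK) => h; lra.
Qed.

Lemma sconj_real r : sconj (of_real K r) = of_real K r.
Proof.
apply: (addrI (of_real K r)); rewrite (addsJ hK) (sre_real hK) -(of_realD hK).
by congr of_real; ring.
Qed.

Lemma sre_mulr_real a r : sre (a * of_real K r) = r * sre a.
Proof.
have h : sre (a * of_real K r + sconj (a * of_real K r)) = 2 * (r * sre a).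
  rewrite sconjM sconj_real (of_realC hK) -mulrDl (addsJ hK) -(of_realM hK).
  rewrite (sre_real hK).
  by ring.
by move: h; rewrite (sreD hK) sre_conj => h; lra.
Qed.

Lemma sabs2_0 : sabs2 (0 : K) = 0.
Proof. by rewrite /sabs2 mulr0 sre0. Qed.

Lemma sabs2_ge0 a : 0 <= sabs2 a.
Proof.
have [->|a0] := eqVneq a 0; first by rewrite sabs2_0.
exact: ltW (sabs2_gt0 hK a0).
Qed.

Lemma sabs2_eq0 a : sabs2 a = 0 -> a = 0.
Proof.
move=> a0; apply/eqP; apply: contraT => /(sabs2_gt0 hK).
by rewrite a0 ltxx.
Qed.

Lemma sre_ext c d :
  (forall a, sre (sconj a * c) = sre (sconj a * d)) -> c = d.
Proof.
move=> cd; apply/eqP; rewrite -subr_eq0; apply/eqP/sabs2_eq0.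
by rewrite /sabs2 mulrBr sreB cd subrr.
Qed.

Lemma sabs2J a : sabs2 (sconj a) = sabs2 a.
Proof. by rewrite /sabs2 sconjK (sreC hK). Qed.

Lemma sabs2M a b : sabs2 (a * b) = sabs2 a * sabs2 b.
Proof.
rewrite {1}/sabs2 sconjM -mulrA (mulrA (sconj a)) (mulJs hK).
rewrite (of_realC hK) mulrA.
by rewrite sre_mulr_real.
Qed.

Lemma sabs2_real r : sabs2 (of_real K r) = r ^+ 2.
Proof. by rewrite /sabs2 sconj_real -(of_realM hK) (sre_real hK). Qed.

Lemma sabs2_1 : sabs2 (1 : K) = 1.
Proof. by rewrite -(of_real1 hK) sabs2_real expr1n. Qed.

Lemma sabs2D a b : sabs2 (a + b) = sabs2 a + sabs2 b + 2 * sre (sconj a * b).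
Proof.
rewrite /sabs2 sconjD mulrDl !mulrDr !(sreD hK).
have -> : sre (sconj b * a) = sre (sconj a * b).
  by rewrite -sre_conj sconjM sconjK.
by ring.
Qed.

Definition sinv a : K := sconj a * of_real K (sabs2 a)^-1.

Lemma mulVs a : a != 0 -> sinv a * a = 1.
Proof.
move=> a0; rewrite /sinv -mulrA (of_realC hK) mulrA (mulJs hK) -(of_realM hK).
by rewrite mulfV ?(of_real1 hK) // gt_eqF ?(sabs2_gt0 hK).
Qed.

Lemma mulsJ a : a * sconj a = of_real K (sabs2 a).
Proof. by rewrite -{1}[a]sconjK (mulJs hK) sabs2J. Qed.

Lemma mulsV a : a != 0 -> a * sinv a = 1.
Proof.
move=> a0; rewrite /sinv mulrA mulsJ -(of_realM hK).
by rewrite mulfV ?(of_real1 hK) // gt_eqF ?(sabs2_gt0 hK).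
Qed.

Lemma sre_inv a : sre (sinv a) = (sabs2 a)^-1 * sre a.
Proof. by rewrite sre_mulr_real sre_conj. Qed.

Lemma sabs2_inv a : sabs2 (sinv a) = (sabs2 a)^-1.
Proof.
rewrite /sinv sabs2M sabs2J sabs2_real.
have [->|a0] := eqVneq (sabs2 a) 0; first by rewrite invr0 mul0r.
by rewrite expr2 mulrA mulfV // mul1r.
Qed.

End Scalars.

Section RightScaling.
Variables (R : realType) (K : scalars R) (V : lmodType K^c).
Implicit Types (x y : V) (a b : K).

Lemma rscaleDl x a b : x *> (a + b) = x *> a + x *> b.
Proof. exact: scalerDl. Qed.
Lemma rscaleDr x y a : (x + y) *> a = x *> a + y *> a.
Proof. exact: scalerDr. Qed.
Lemma rscaleN x a : x *> (- a) = - (x *> a).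
Proof. exact: scaleNr. Qed.
Lemma rscaleNl x a : (- x) *> a = - (x *> a).
Proof. exact: scalerN. Qed.
Lemma rscale0 x : x *> (0 : K) = 0.
Proof. exact: scale0r. Qed.
Lemma rscalar1 x : x *> (1 : K) = x.
Proof. exact: scale1r. Qed.
Lemma rscaleM x a b : x *> a *> b = x *> (a * b).
Proof. by rewrite /rscale scalerA. Qed.
Lemma rscale_sumr n (F : 'I_n -> K) x :
  x *> (\sum_(i < n) F i) = \sum_(i < n) x *> F i.
Proof. exact: scaler_suml. Qed.
Lemma rscale_suml n (F : 'I_n -> V) a :
  (\sum_(i < n) F i) *> a = \sum_(i < n) F i *> a.
Proof. exact: scaler_sumr. Qed.

End RightScaling.

(** * Hermitian forms *)

(** Both the inner product and the indefinite form are hermitian; the calculus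
is developed once for the two of them. *)
Record hermitian_form (R : realType) (K : scalars R) (V : lmodType K^c)
    (f : V -> V -> K) : Prop := HermitianForm {
  hformDr : forall x y z, f x (y + z) = f x y + f x z;
  hformZr : forall x y (a : K), f x (y *> a) = f x y * a;
  hformJ : forall x y, f y x = sconj (f x y)
}.

Section HermitianForms.
Variables (R : realType) (K : scalars R) (V : lmodType K^c) (f : V -> V -> K).
Hypotheses (hK : scalar_laws K) (hf : hermitian_form f).
Implicit Types (x y z : V) (a b : K).
Local Notation q x := (sre (f x x)).

Lemma hform0r x : f x 0 = 0.
Proof. by rewrite -(rscale0 0) (hformZr hf) mulr0. Qed.
Lemma hformNr x y : f x (- y) = - f x y.
Proof. by rewrite -[y]rscalar1 -rscaleN !(hformZr hf) mulrN mulr1. Qed.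
Lemma hformBr x y z : f x (y - z) = f x y - f x z.
Proof. by rewrite (hformDr hf) hformNr. Qed.
Lemma hformDl x y z : f (x + y) z = f x z + f y z.
Proof. by rewrite !(hformJ hf z) (hformDr hf) sconjD. Qed.
Lemma hform0l x : f 0 x = 0.
Proof. by rewrite (hformJ hf) hform0r (sconj0 K). Qed.
Lemma hformNl x y : f (- x) y = - f x y.
Proof. by rewrite !(hformJ hf y) hformNr (sconjN). Qed.
Lemma hformBl x y z : f (x - y) z = f x z - f y z.
Proof. by rewrite hformDl hformNl. Qed.
Lemma hformZl x y a : f (x *> a) y = sconj a * f x y.
Proof. by rewrite !(hformJ hf y) (hformZr hf) sconjM. Qed.
Lemma hform_sumr n x (F : 'I_n -> V) :
  f x (\sum_(i < n) F i) = \sum_(i < n) f x (F i).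
Proof. by apply: (big_morph (f x) (hformDr hf x)); exact: hform0r. Qed.
Lemma hform_suml n x (F : 'I_n -> V) :
  f (\sum_(i < n) F i) x = \sum_(i < n) f (F i) x.
Proof.
by apply: (big_morph (f^~ x) (fun y z => hformDl y z x)); exact: hform0l.
Qed.

Lemma hform_eq0C x y : f x y = 0 -> f y x = 0.
Proof. by move=> xy; rewrite (hformJ hf) xy (sconj0 K). Qed.

Lemma sre_formC x y : sre (f y x) = sre (f x y).
Proof. by rewrite (hformJ hf) (sre_conj hK). Qed.

(** A scalar equal to its conjugate is real. *)
Lemma hform_diag x : f x x = of_real K (q x).
Proof.
have h : f x x + f x x = of_real K (2 * q x).
  by rewrite -(addsJ hK) -(hformJ hf).
have half : of_real K 2^-1 + of_real K 2^-1 = 1.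
  by rewrite -(of_realD hK) -(of_real1 hK); congr of_real; lra.
rewrite -[LHS]mulr1 -half mulrDr -mulrDl h -(of_realM hK).
by congr of_real; lra.
Qed.

Lemma qformD x y : q (x + y) = q x + q y + 2 * sre (f x y).
Proof.
rewrite hformDl !(hformDr hf) !(sreD hK) (sre_formC x y).
by ring.
Qed.

Lemma qformN x : q (- x) = q x.
Proof. by rewrite hformNl hformNr opprK. Qed.

Lemma qformB x y : q (x - y) = q x + q y - 2 * sre (f x y).
Proof. by rewrite qformD qformN hformNr (sreN hK); ring. Qed.

Lemma qform0 : q 0 = 0.
Proof. by rewrite hform0r (sre0 hK). Qed.

Lemma qformZ x a : q (x *> a) = sabs2 a * q x.
Proof.
rewrite hformZl (hformZr hf) hform_diag mulrA -(of_realC hK) -mulrA (mulJs hK).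
by rewrite -(of_realM hK) !(sre_real hK) mulrC.
Qed.

Lemma sre_formZr x y r : sre (f x (y *> of_real K r)) = r * sre (f x y).
Proof. by rewrite (hformZr hf) (sre_mulr_real hK). Qed.

Lemma qformDorth x y : f x y = 0 -> q (x + y) = q x + q y.
Proof. by move=> xy; rewrite qformD xy (sre0 hK) mulr0 addr0. Qed.

Lemma qform_sum_orth n (F : 'I_n -> V) :
  (forall i j, i != j -> f (F i) (F j) = 0) ->
  q (\sum_(i < n) F i) = \sum_(i < n) q (F i).
Proof.
elim: n F => [|n IH] F orth; first by rewrite !big_ord0 qform0.
rewrite !big_ord_recr /= qformDorth; last first.
  rewrite hform_suml big1 // => i _; apply: orth.
  by rewrite -val_eqE /= neq_ltn ltn_ord.
by rewrite IH // => i j ij; apply: orth; apply: contra ij => /eqP[/val_inj->].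
Qed.

(** Used instead of solving linear systems over the division ring of scalars:
a condition of orthogonality is met at the cost of one vector of an orthogonal
family, without leaving the span nor changing the square. *)
Lemma unit_combination_orth x y z : f x y = 0 -> q x = q y ->
  exists a b, f z (x *> a + y *> b) = 0 /\
    q (x *> a + y *> b) = q x.
Proof.
move=> xy qxy.
suff [a [b [ab0 zab]]] : exists a b,
    0 < sabs2 a + sabs2 b /\ f z (x *> a + y *> b) = 0.
  pose r := (Num.sqrt (sabs2 a + sabs2 b))^-1.
  exists (a * of_real K r), (b * of_real K r).
  rewrite -!rscaleM -rscaleDr (hformZr hf) zab mul0r; split=> //.
  rewrite qformZ (sabs2_real hK) qformDorth; last first.
    by rewrite hformZl (hformZr hf) xy mul0r mulr0.
  rewrite !qformZ -qxy -mulrDl mulrA exprVn sqr_sqrtr ?ltW //.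
  by rewrite mulVf ?gt_eqF // mul1r.
have [z0|z0] := eqVneq (f z x) 0.
  exists 1, 0; rewrite rscalar1 rscale0 addr0 z0 (sabs2_1 hK) (sabs2_0 hK).
  by rewrite addr0 ltr01.
exists (- (sinv (f z x) * f z y)), 1; split.
  by rewrite (sabs2_1 hK) ltr_wpDl ?(sabs2_ge0 hK) ?ltr01.
rewrite (hformDr hf) !(hformZr hf) mulr1 mulrN mulrA (mulsV hK) // mul1r.
exact: addNr.
Qed.

End HermitianForms.

(** * The indefinite form in a Hilbert basis *)

Section SignatureBasis.
Variables (R : realType) (K : scalars R) (p : nat) (H : qspace K p).
Hypothesis hK : scalar_laws K.
Implicit Types (x y z : H) (a b : K).

Lemma ip_hermitian : hermitian_form (@ip R K H).
Proof. by split; [exact: ipDr | exact: ipZr | exact: ip_conj]. Qed.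

Lemma phi_hermitian : hermitian_form (@phi R K p H).
Proof. by split; [exact: phiDr | exact: phiZr | exact: phi_conj]. Qed.

Let hip := ip_hermitian.
Let hphi := phi_hermitian.

Local Notation sqn x := (sre (ip x x)).

Lemma sqn_ge0 x : 0 <= sqn x.
Proof.
have [->|/ip_gt0/ltW//] := eqVneq x 0.
by rewrite (qform0 hK hip).
Qed.

Lemma hnormE x : hnorm x ^+ 2 = sqn x.
Proof. by rewrite sqr_sqrtr // sqn_ge0. Qed.

Lemma hnorm_eq0 x : hnorm x = 0 -> x = 0.
Proof.
move=> x0; apply/eqP; apply: contraT => /ip_gt0.
by rewrite -hnormE x0 expr0n ltxx.
Qed.

Section Coordinates.
Variables (e : nat -> H).
Hypothesis eorth : forall i j, ip (e i) (e j) = (i == j)%:R.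

Lemma bessel n x : \sum_(i < n) sabs2 (ip (e i) x) <= sqn x.
Proof.
pose y := \sum_(i < n) e i *> ip (e i) x.
suff h : sqn (x - y) = sqn x - \sum_(i < n) sabs2 (ip (e i) x).
  by rewrite -subr_ge0 -h sqn_ge0.
rewrite (qformB hK hip).
have -> : sqn y = \sum_(i < n) sabs2 (ip (e i) x).
  rewrite (qform_sum_orth hK hip).
    apply: eq_bigr => i _; rewrite (qformZ hK hip) eorth eqxx.
    by rewrite -(of_real1 hK) (sre_real hK) mulr1.
  move=> i j ij; rewrite (hformZl hip) ipZr eorth val_eqE (negbTE ij).
  by rewrite mul0r mulr0.
have -> : sre (ip x y) = \sum_(i < n) sabs2 (ip (e i) x).
  rewrite (hform_sumr hip) (sre_sum hK); apply: eq_bigr => i _.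
  by rewrite ipZr (ip_conj (e i) x).
by ring.
Qed.

Let S x n : R := \sum_(i < n)
  (if (i < p)%N then sabs2 (ip (e i) x) else - sabs2 (ip (e i) x)).
Hypothesis sig : forall x, S x @ \oo --> Q x.

Lemma Q_le_sqn x : `|Q x| <= sqn x.
Proof.
have S_le n : `|S x n| <= sqn x.
  apply: le_trans (bessel n x); apply: le_trans (ler_norm_sum _ _ _) _.
  apply: ler_sum => i _; case: ifP => _;
    rewrite ?normrN ger0_norm ?(sabs2_ge0 hK) //.
have := ler_cvg_to (cvg_norm (@sig x)) (cvg_cst _ : _ --> sqn x).
by apply; apply: nearW => n; exact: S_le.
Qed.

(** Polarization: only the i-th term of the series of [Q (e i *> a + x)]
differs from that of [Q x], so the form is diagonal in the basis. *)
Lemma phi_coord i x :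
  phi (e i) x = (if (i < p)%N then 1 else -1) * ip (e i) x.
Proof.
set s : K := if _ then _ else _.
apply: (sre_ext hK) => a.
pose r : R := if (i < p)%N then 1 else -1.
have sE : s = of_real K r.
  by rewrite /s /r; case: ifP; rewrite ?(of_realN hK) (of_real1 hK).
have lim1 : (fun n => S (e i *> a + x) n - S (e i *> a) n - S x n) @ \oo
    --> 2 * sre (phi (e i *> a) x).
  have -> : 2 * sre (phi (e i *> a) x) = Q (e i *> a + x) - Q (e i *> a) - Q x.
    by rewrite /Q (qformD hK hphi); ring.
  by apply: cvgB; [apply: cvgB|]; exact: sig.
have lim2 : (fun n => S (e i *> a + x) n - S (e i *> a) n - S x n) @ \oo
    --> 2 * (r * sre (sconj a * ip (e i) x)).
  apply: cvg_near_cst; exists i.+1 => // n /= lin.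
  rewrite /S -!sumrB (bigD1 (Ordinal lin)) //= big1 ?addr0; last first.
    move=> j; rewrite -val_eqE /= => ji.
    rewrite !(ipDr, ipZr) eorth (negbTE ji) mul0r add0r sabs2_0 //.
    by case: ifP => _; rewrite !oppr0 addr0 subrr.
  rewrite !(ipDr, ipZr) eorth eqxx mul1r (sabs2D hK) /r.
  by case: ifP => _; ring.
rewrite sE (of_realC hK) [in RHS]mulrA (sre_mulr_real hK).
have : 2 * sre (phi (e i *> a) x) = 2 * (r * sre (sconj a * ip (e i) x)).
  exact: (norm_cvg_unique lim1 lim2).
by rewrite (hformZl hphi) => h; lra.
Qed.

Hypothesis total :
  forall x, (fun n => hnorm (x - \sum_(i < n) e i *> ip (e i) x)) @ \oo --> 0.

Lemma orth_to_positive_part x :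
  (forall i, (i < p)%N -> phi (e i) x = 0) -> x != 0 -> Q x < 0.
Proof.
move=> xe x0.
have ip0 i : (i < p)%N -> ip (e i) x = 0.
  by move=> ip; have := xe _ ip; rewrite phi_coord ip mul1r.
have Sle i n : (i < n)%N -> S x n <= - sabs2 (ip (e i) x).
  move=> lin; rewrite /S (bigD1 (Ordinal lin)) //= -[leRHS]addr0 lerD //.
    by case: ifP => // /ip0->; rewrite sabs2_0 // oppr0.
  apply: sumr_le0 => j _; case: ifP => [/ip0->|_]; rewrite ?sabs2_0 //.
  by rewrite oppr_le0 sabs2_ge0.
have Qle i : Q x <= - sabs2 (ip (e i) x).
  have := ler_cvg_to (@sig x) (cvg_cst _ : _ --> - sabs2 (ip (e i) x)).
  by apply; exists i.+1 => // n /= lin; exact: Sle.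
rewrite lt_neqAle; apply/andP; split; last first.
  by apply: le_trans (Qle 0%N) _; rewrite oppr_le0 sabs2_ge0.
apply: contra x0 => /eqP Q0; apply/eqP/hnorm_eq0.
have ipx i : ip (e i) x = 0.
  apply: (sabs2_eq0 hK); apply/eqP; rewrite eq_le sabs2_ge0 // andbT.
  by have := Qle i; rewrite Q0 oppr_ge0.
have := total x; under eq_fun do
  (rewrite big1 ?subr0; last by move=> i _; rewrite ipx rscale0).
by move=> h; apply: (norm_cvg_unique (cvg_cst _) h).
Qed.

End Coordinates.

(** The algebraic content of the signature. Besides it, the Hilbert space
structure is only used to bound quasi-reflections. *)
Lemma signature_basis : exists e : nat -> H,
  [/\ forall i, Q (e i) = if (i < p)%N then 1 else -1,
      forall i j, i != j -> phi (e i) (e j) = 0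
    & forall x, (forall i, (i < p)%N -> phi (e i) x = 0) -> x != 0 -> Q x < 0].
Proof.
have [e [[eorth total] sig]] := phi_signature H.
exists e; split.
- move=> i; rewrite /Q (phi_coord eorth sig) eorth eqxx mulr1.
  by case: ifP; rewrite ?(sreN hK) -(of_real1 hK) (sre_real hK).
- by move=> i j ij; rewrite (phi_coord eorth sig) eorth (negbTE ij) mulr0.
- exact: orth_to_positive_part eorth sig total.
Qed.

(** Cauchy-Schwarz, up to the constant, from [`|Q x| <= sre (ip x x)]. *)
Lemma phi_bounded v z :
  sabs2 (phi v z) <= (1 + sqn v) ^+ 2 * sqn z.
Proof.
have Qle x : `|Q x| <= sqn x.
  by have [e [[eorth _] sig]] := phi_signature H; exact: Q_le_sqn eorth sig x.
have le2 x y : 2 * sre (phi x y) <= sqn x + sqn y.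
  have h1 := le_trans (ler_norm _) (Qle (x + y)).
  have h2 : - Q (x - y) <= sqn (x - y).
    by apply: le_trans (Qle _); rewrite -normrN ler_norm.
  move: h1 h2; rewrite /Q (qformD hK hphi x y) (qformB hK hphi x y).
  by rewrite (qformD hK hip x y) (qformB hK hip x y) => h1 h2; lra.
set a := phi v z; set c := 1 + sqn v.
have c1 : 1 <= c by rewrite /c lerDl sqn_ge0.
have c0 : 0 < c by apply: lt_le_trans c1.
(* scale v by a / c, whose modulus makes the quadratic term absorbable *)
have := le2 (v *> a *> of_real K c^-1) z.
rewrite !(qformZ hK hip) (sabs2_real hK) !(hformZl hphi) -/a (sconj_real hK).
rewrite (of_realC hK) (mulJs hK) -(of_realM hK) (sre_real hK) => h.
have vc : sqn v <= c by rewrite /c; lra.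
have A0 := sabs2_ge0 hK a; have z0 := sqn_ge0 z.
set A := sabs2 a in h A0 *; set Z := sqn z in h z0 *; set N := sqn v in h vc.
have h' : 2 * (A * c) <= A * N + Z * c ^+ 2.
  have -> : 2 * (A * c) = (2 * (A * c^-1)) * c ^+ 2.
    by field; rewrite gt_eqF.
  have -> : A * N + Z * c ^+ 2 = (c^-1 ^+ 2 * (A * N) + Z) * c ^+ 2.
    by field; rewrite gt_eqF.
  by rewrite ler_wpM2r // exprn_ge0 // ltW.
have AN : A * N <= A * c by rewrite ler_wpM2l.
have Ac : A <= A * c by rewrite ler_peMr.
by rewrite mulrC; lra.
Qed.

End SignatureBasis.

(** * Quasi-reflections *)

Section Geometry.
Variables (R : realType) (K : scalars R) (p : nat) (H : qspace K p).
Hypothesis hK : scalar_laws K.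
Implicit Types (x y z u v w : H) (a b m : K) (s : seq H) (g h : orth H).

Let hip := ip_hermitian H.
Let hphi := phi_hermitian H.
Local Notation B x y := (sre (phi x y)).

Lemma QD x y : Q (x + y) = Q x + Q y + 2 * B x y.
Proof. exact: qformD hK hphi x y. Qed.
Lemma QB x y : Q (x - y) = Q x + Q y - 2 * B x y.
Proof. exact: qformB hK hphi x y. Qed.
Lemma QZ x a : Q (x *> a) = sabs2 a * Q x.
Proof. exact: qformZ hK hphi x a. Qed.
Lemma QZr x r : Q (x *> of_real K r) = r ^+ 2 * Q x.
Proof. by rewrite QZ sabs2_real. Qed.
Lemma Q0 : Q (0 : H) = 0.
Proof. exact: qform0 hK hphi. Qed.
Lemma phi_diag x : phi x x = of_real K (Q x).
Proof. exact: hform_diag hK hphi x. Qed.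
Lemma phi_orthC x y : phi x y = 0 -> phi y x = 0.
Proof. exact: hform_eq0C hphi x y. Qed.
Lemma BC x y : B y x = B x y.
Proof. exact: sre_formC hK hphi x y. Qed.
Lemma QDorth x y : phi x y = 0 -> Q (x + y) = Q x + Q y.
Proof. exact: qformDorth hK hphi x y. Qed.

Lemma orthN g x : g (- x) = - g x.
Proof. by rewrite -[x in LHS]rscalar1 -rscaleN orthZ rscaleN rscalar1. Qed.

Lemma orthB g x y : g (x - y) = g x - g y.
Proof. by rewrite orthD orthN. Qed.

Lemma orthQ g x : Q (g x) = Q x.
Proof. by case: (orthP g). Qed.

Lemma orth_phi g x y : phi (g x) (g y) = phi x y.
Proof.
have gB u v : B (g u) (g v) = B u v.
  by have := orthQ g (u + v); rewrite orthD !QD !orthQ => h; lra.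
by apply: (sre_ext hK) => a; rewrite -!(hformZl hphi) -orthZ gB.
Qed.

Lemma orthKV g x : g (g^-1%g x) = x.
Proof. by have [_ h _] := orth_inv_funP g; exact: h. Qed.

Lemma orthVK g x : g^-1%g (g x) = x.
Proof. by have [h _ _] := orth_inv_funP g; exact: h. Qed.

Definition qrefl v m z := z - v *> (m * phi v z).

(** In other words [m + sconj m = sconj m * q * m], which for [q = Q v] makes
[qrefl v m] an isometry. Over the reals a nonzero [m] has to be [2 / q], that of
the reflection; over the other scalars the line of [v] can be turned by any
number of modulus 1. *)
Definition qrefl_param (q : R) m := 2 * sre m = q * sabs2 m.

Lemma qrefl_paramJ q m : qrefl_param q m -> qrefl_param q (sconj m).
Proof. by rewrite /qrefl_param (sre_conj hK) (sabs2J hK). Qed.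

Lemma qreflK v m : qrefl_param (Q v) m ->
  cancel (qrefl v m) (qrefl v (sconj m)).
Proof.
move=> vm z; rewrite /qrefl (hformBr hphi) phiZr phi_diag.
set a := phi v z.
have -> : sconj m * (a - of_real K (Q v) * (m * a)) = - (m * a).
  rewrite mulrBr !mulrA -(mulrA (sconj m)) (of_realC hK (Q v)) mulrA.
  rewrite (mulJs hK) -(of_realM hK) [sabs2 m * _]mulrC -vm -(addsJ hK) mulrDl.
  by rewrite opprD addrCA subrr addr0.
by rewrite rscaleN opprK subrK.
Qed.

Lemma qreflKV v m : qrefl_param (Q v) m ->
  cancel (qrefl v (sconj m)) (qrefl v m).
Proof. by move=> /qrefl_paramJ/qreflK; rewrite sconjK. Qed.

Lemma Q_qrefl v m z : qrefl_param (Q v) m -> Q (qrefl v m z) = Q z.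
Proof.
move=> vm; rewrite /qrefl QB QZ phiZr (phi_conj v z) (sreC hK) -mulrA.
rewrite (mulsJ hK) (sre_mulr_real hK) (sabs2M hK).
have := vm; rewrite /qrefl_param => h.
have -> : sabs2 m * sabs2 (phi v z) * Q v = (2 * sre m) * sabs2 (phi v z).
  by rewrite h; ring.
by ring.
Qed.

Lemma bounded_qrefl v m : bounded_op (qrefl v m).
Proof.
pose N := sre (ip v v).
pose C := 2 + 2 * (sabs2 m * (N * (1 + N) ^+ 2)).
exists (Num.sqrt C) => z; set a := phi v z.
have N0 : 0 <= N := sqn_ge0 hK v.
have m0 := sabs2_ge0 hK m; have z0 := sqn_ge0 hK z.
have C0 : 0 <= C.
  by rewrite addr_ge0 ?mulr_ge0 ?exprn_ge0 ?addr_ge0.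
rewrite -sqrtrM // ler_sqrt ?mulr_ge0 //.
have le1 : sre (ip (v *> (m * a)) (v *> (m * a))) <=
    sabs2 m * (N * (1 + N) ^+ 2) * sre (ip z z).
  rewrite (qformZ hK hip) (sabs2M hK) -/N.
  have -> : sabs2 m * (N * (1 + N) ^+ 2) * sre (ip z z) =
      sabs2 m * (((1 + N) ^+ 2 * sre (ip z z)) * N) by ring.
  by rewrite -mulrA ler_wpM2l // ler_wpM2r // phi_bounded.
have := sqn_ge0 hK (z + v *> (m * a)).
by rewrite /qrefl (qformD hK hip) (qformB hK hip) /C -/a => h; lra.
Qed.

Lemma linear_qrefl v m : linear (qrefl v m).
Proof.
move=> c x y; rewrite /qrefl phiDr.
have -> : phi v (c *: x) = phi v x * c by exact: phiZr.
rewrite mulrDr rscaleDl scalerBr mulrA -rscaleM opprD addrACA.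
by [].
Qed.

Lemma is_orth_qrefl v m : qrefl_param (Q v) m -> is_orth (qrefl v m).
Proof.
move=> vm; split; [exact: linear_qrefl|exact: bounded_qrefl| |].
  exists (qrefl v (sconj m)).
  by split; [exact: qreflK|exact: qreflKV|exact: bounded_qrefl].
by move=> x; exact: Q_qrefl.
Qed.

Lemma orth_qrefl g v m z : g (qrefl v m z) = qrefl (g v) m (g z).
Proof. by rewrite /qrefl orthB orthZ orth_phi. Qed.

Lemma qrefl_orth v m z : phi v z = 0 -> qrefl v m z = z.
Proof. by move=> vz; rewrite /qrefl vz mulr0 rscale0 subr0. Qed.

Definition negative_qrefl g :=
  exists v m, [/\ Q v < 0, qrefl_param (Q v) m & forall z, g z = qrefl v m z].

Lemma orth_of_qrefl v m : qrefl_param (Q v) m ->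
  exists g, forall z, g z = qrefl v m z.
Proof. by move=> vm; exists (Orth (is_orth_qrefl vm)). Qed.

(** The parameter is the inverse of [phi (x - y) x], whose real part is half of
[Q (x - y)]. *)
Lemma negative_qrefl_move x y : Q x = Q y -> Q (x - y) < 0 ->
  exists g, [/\ negative_qrefl g, g x = y
    & forall z, phi (x - y) z = 0 -> g z = z].
Proof.
move=> Qxy neg; set v := x - y in neg *; pose c := phi v x.
have cB : 2 * sre c = Q v.
  by rewrite /c /v QB (hformBl hphi) (sreB hK) (BC x y) -/(Q x) Qxy; ring.
have c0 : c != 0.
  by apply: contraTneq neg => c0; rewrite -cB c0 (sre0 hK) mulr0 ltxx.
have cond : qrefl_param (Q v) (sinv c).
  by rewrite /qrefl_param (sre_inv hK) (sabs2_inv hK) -cB; ring.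
have [g gE] := orth_of_qrefl cond; exists g; split.
- by exists v, (sinv c).
- by rewrite gE /qrefl -/c (mulVs hK) // rscalar1 /v subKr.
- by move=> z vz; rewrite gE qrefl_orth.
Qed.

Definition ortho_proj v x := x - v *> (of_real K (Q v)^-1 * phi v x).

Lemma phi_ortho_proj v x : Q v != 0 -> phi v (ortho_proj v x) = 0.
Proof.
move=> v0; rewrite /ortho_proj (hformBr hphi) phiZr phi_diag mulrA.
by rewrite -(of_realM hK) mulfV // (of_real1 hK) mul1r subrr.
Qed.

Lemma Q_ortho_proj v x : Q v != 0 ->
  Q (ortho_proj v x) = Q x - (Q v)^-1 * sabs2 (phi v x).
Proof.
move=> v0; rewrite /ortho_proj QB QZ (sabs2M hK) (sabs2_real hK) phiZr.
rewrite (of_realC hK) mulrA (sre_mulr_real hK) (phi_conj v x).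
by rewrite -/(sabs2 _); field.
Qed.

(** * Negative vectors orthogonal to finitely many vectors *)

Section DiagonalBasis.
Variable e : nat -> H.
Hypothesis Qe : forall i, Q (e i) = if (i < p)%N then 1 else -1.
Hypothesis eorth : forall i j, i != j -> phi (e i) (e j) = 0.
Hypothesis eneg :
  forall x, (forall i, (i < p)%N -> phi (e i) x = 0) -> x != 0 -> Q x < 0.

(** Orthogonality to one more vector is obtained by combining the terms of the
sequence two by two. *)
Lemma negative_orthonormal_sequence s : exists f : nat -> H,
  [/\ forall i, Q (f i) = -1, forall i j, i != j -> phi (f i) (f j) = 0
    & forall x i, x \in s -> phi x (f i) = 0].
Proof.
elim: s => [|x s [f [Qf forth fs]]].
  exists (fun i => e (p + i)%N); split=> [i|i j ij|//].
    by rewrite Qe ltnNge leq_addr.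
  by apply: eorth; rewrite eqn_add2l.
have pair i : exists c : K * K,
    phi x (f i.*2 *> c.1 + f i.*2.+1 *> c.2) = 0 /\
    Q (f i.*2 *> c.1 + f i.*2.+1 *> c.2) = -1.
  have ne : i.*2 != i.*2.+1 by rewrite neq_ltn ltnSn.
  have [|a [b [xab Qab]]] := unit_combination_orth hK hphi x (forth _ _ ne).
    by rewrite -/(Q _) -/(Q _) !Qf.
  by exists (a, b); split; rewrite // /Q Qab -/(Q _) Qf.
have [c cP] := choice pair.
exists (fun i => f i.*2 *> (c i).1 + f i.*2.+1 *> (c i).2); split.
- by move=> i; have [] := cP i.
- move=> i j ij.
  have ij2 (k l : bool) : (k + i.*2 != l + j.*2)%N.
    apply: contra ij => /eqP/(congr1 half).
    by rewrite !half_bit_double => ->.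
  rewrite (hformDl hphi) !(hformZl hphi) !phiDr !phiZr.
  have := ij2 false false; have := ij2 false true.
  have := ij2 true false; have := ij2 true true.
  rewrite !add0n !add1n => h1 h2 h3 h4.
  by rewrite !forth // !(mul0r, mulr0, addr0).
- move=> y i; rewrite inE => /orP[/eqP->|ys]; first by have [] := cP i.
  by rewrite phiDr !phiZr !fs // !mul0r addr0.
Qed.

Lemma negative_orth s (q : R) : q < 0 ->
  exists k, Q k = q /\ forall x, x \in s -> phi x k = 0.
Proof.
move=> q0; have [f [Qf _ fs]] := negative_orthonormal_sequence s.
exists (f 0%N *> of_real K (Num.sqrt (- q))); split.
  by rewrite QZr Qf sqr_sqrtr ?oppr_ge0 ?ltW // mulrN1 opprK.
by move=> x xs; rewrite phiZr fs // mul0r.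
Qed.

Lemma phi_nondegenerate u : u != 0 -> exists z, phi u z != 0.
Proof.
move=> u0; apply: contrapT => h.
have uz z : phi u z = 0.
  by apply/eqP; apply: contrapT => uz; apply: h; exists z; apply/negP.
have : Q u < 0 by apply: eneg => // i _; apply: phi_orthC.
by rewrite /Q uz (sre0 hK) ltxx.
Qed.

(** For [v] and [w] orthogonal, that [v + w *> b] is an eigenvector for every
[b] forces the eigenvalues of [v] and [w] to agree and to be central; and every
vector is a difference of two negative ones. *)
Lemma negative_eigenvectors_scalar g :
  (forall v, Q v < 0 -> exists a, g v = v *> a) ->
  exists a, central_unit a /\ forall x, g x = x *> a.
Proof.
move=> eig.
have cancel v (c d : K) : Q v < 0 -> phi v (v *> c) = phi v (v *> d) -> c = d.
  move=> v0; rewrite !phiZr phi_diag.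
  move=> /(congr1 (fun t => of_real K (Q v)^-1 * t)).
  rewrite !mulrA -(of_realM hK) mulVf ?(of_real1 hK) ?mul1r //.
  by rewrite lt_eqF.
have pair v w (c d : K) b : Q v < 0 -> Q w < 0 -> phi v w = 0 ->
    g v = v *> c -> g w = w *> d -> d * b = b * c.
  move=> v0 w0 vw gv gw.
  have [|a] := eig (v + w *> b).
    rewrite QDorth; last by rewrite phiZr vw mul0r.
    by rewrite QZ ltr_wnDr // mulr_ge0_le0 ?(sabs2_ge0 hK) // ltW.
  rewrite orthD orthZ gv gw rscaleDr !rscaleM => vwa.
  have ca : c = a.
    apply: (cancel v) => //; have := congr1 (phi v) vwa.
    by rewrite !phiDr !phiZr vw !mul0r !addr0.
  apply: (cancel w) => //; have := congr1 (phi w) vwa.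
  by rewrite !phiDr !phiZr (phi_orthC vw) !mul0r !add0r ca.
have [v [Qv _]] := negative_orth [::] (ltrN10 R).
have v0 : Q v < 0 by rewrite Qv ltrN10.
have [c gv] := eig _ v0.
have eigc w : Q w < 0 -> g w = w *> c.
  move=> w0; have [k [Qk ks]] := negative_orth [:: v; w] (ltrN10 R).
  have k0 : Q k < 0 by rewrite Qk ltrN10.
  have vk : phi v k = 0 by rewrite ks ?mem_head.
  have wk : phi w k = 0 by rewrite ks // !inE eqxx orbT.
  have [d gk] := eig _ k0; have [d' gw] := eig _ w0.
  have := pair _ _ _ _ 1 v0 k0 vk gv gk; have := pair _ _ _ _ 1 w0 k0 wk gw gk.
  by rewrite gw !mulr1 !mul1r => <- <-.
exists c; split.
  split.
    move=> b; have [k [Qk ks]] := negative_orth [:: v] (ltrN10 R).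
    have k0 : Q k < 0 by rewrite Qk ltrN10.
    have vk : phi v k = 0 by rewrite ks ?mem_head.
    exact: pair v0 k0 vk gv (eigc _ k0).
  rewrite (mulJs hK) -(of_real1 hK); congr of_real.
  have := orthQ g v; rewrite gv QZ Qv => h; lra.
move=> x.
have [|k [Qk ks]] := @negative_orth [:: x] (- (`|Q x| + 1)).
  by rewrite oppr_lt0 ltr_wpDl.
have k0 : Q k < 0 by rewrite Qk oppr_lt0 ltr_wpDl.
have xk0 : Q (x + k) < 0.
  rewrite QDorth ?ks ?mem_head // Qk; have := ler_norm (Q x) => h; lra.
have := eigc _ xk0; rewrite orthD (eigc _ k0) rscaleDr; exact: addIr.
Qed.

(** Add a vector on which [phi u] does not vanish to a large positive multiple
of the projection of [e 0]. *)
Lemma nonneg_orth_not_in_kernel v u : (0 < p)%N -> Q v < 0 ->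
  u != 0 -> phi v u = 0 ->
  exists y, [/\ phi v y = 0, 0 <= Q y & phi u y != 0].
Proof.
move=> p0 v0 u0 vu; have vN0 : Q v != 0 by rewrite lt_eqF.
pose y1 := ortho_proj v (e 0%N).
have vy1 : phi v y1 = 0 by exact: phi_ortho_proj.
have Qy1 : 1 <= Q y1.
  rewrite Q_ortho_proj // Qe p0 lerBrDl gerDr.
  by rewrite mulr_le0_ge0 ?(sabs2_ge0 hK) // invr_le0 ltW.
have [uy1|uy1] := eqVneq (phi u y1) 0; last first.
  by exists y1; split=> //; apply: le_trans Qy1.
have [z uz] := phi_nondegenerate u0.
pose y2 := ortho_proj v z.
have vy2 : phi v y2 = 0 by exact: phi_ortho_proj.
have uy2 : phi u y2 != 0.
  by rewrite /y2 /ortho_proj (hformBr hphi) phiZr (phi_orthC vu) mul0r subr0.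
pose t := `|Q y2| + 2 * `|B y1 y2| + 1.
exists (y1 *> of_real K t + y2); split.
- by rewrite phiDr phiZr vy1 vy2 mul0r addr0.
- rewrite QD QZr (hformZl hphi) (sconj_real hK) (of_realC hK).
  rewrite (sre_mulr_real hK).
  have h1 : - `|Q y2| <= Q y2 by rewrite lerNl -normrN ler_norm.
  have h2 : - `|B y1 y2| <= B y1 y2 by rewrite lerNl -normrN ler_norm.
  have h3 := normr_ge0 (Q y2); have h4 := normr_ge0 (B y1 y2).
  have t1 : 1 <= t by rewrite /t; lra.
  have h5 : t ^+ 2 <= t ^+ 2 * Q y1 by rewrite ler_peMr // sqr_ge0.
  have h6 : t * - `|B y1 y2| <= t * B y1 y2 by rewrite ler_wpM2l //; lra.
  have h7 : `|Q y2| <= t * `|Q y2| by rewrite ler_peMl.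
  have h8 : t ^+ 2 = t * `|Q y2| + 2 * (t * `|B y1 y2|) + t.
    by rewrite expr2 {2}/t; ring.
  by lra.
- by rewrite phiDr phiZr uy1 mul0r add0r.
Qed.

(** The two conditions on the products fix a component [w0] of [w], which can
be given a nonnegative square; a negative vector orthogonal to everything then
adjusts the square of [w]. The same argument covers definite, hyperbolic and
degenerate planes of [u] and [v]. *)
Lemma orthogonal_twin u v : (0 < p)%N -> Q v < 0 -> (forall a, u <> v *> a) ->
  exists w, [/\ Q w = Q v, phi v w = 0 & phi u w = phi u v].
Proof.
move=> p0 v0 uv; have vN0 : Q v != 0 by rewrite lt_eqF.
pose u' := ortho_proj v u.
have vu' : phi v u' = 0 by exact: phi_ortho_proj.
have u'0 : u' != 0.
  by apply: contra_not_neq (uv (of_real K (Q v)^-1 * phi v u)) => /subr0_eq.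
have [y [vy Qy u'y]] := nonneg_orth_not_in_kernel p0 v0 u'0 vu'.
have uy : phi u y = phi u' y.
  rewrite /u' /ortho_proj (hformBl hphi) (hformZl hphi) vy mulr0 subr0 //.
pose w0 := y *> (sinv (phi u' y) * phi u v).
have Qw0 : 0 <= Q w0 by rewrite QZ mulr_ge0 ?(sabs2_ge0 hK).
have [|k [Qk ks]] := @negative_orth [:: v; u; w0] (Q v - Q w0).
  by rewrite ltrBlDr ltr_wpDr.
have [vk uk wk] : [/\ phi v k = 0, phi u k = 0 & phi w0 k = 0].
  by split; apply: ks; rewrite !inE eqxx ?orbT.
exists (w0 + k); split.
- by rewrite QDorth // Qk addrC subrK.
- by rewrite phiDr phiZr vy vk mul0r addr0.
- by rewrite phiDr phiZr uy mulrA (mulsV hK) // mul1r uk addr0.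
Qed.

End DiagonalBasis.
End Geometry.

(** * Normal subgroups and agreement on finite sets *)

Section Density.
Variables (R : realType) (K : scalars R) (p : nat) (H : qspace K p).
Hypotheses (hK : scalar_laws K) (p_gt0 : (0 < p)%N).
Implicit Types (x y z u v w : H) (m : K) (s : seq H) (g h n : orth H).

Let hphi := phi_hermitian H.
Local Notation B x y := (sre (phi x y)).

Record orth_subgroup (A : set (orth H)) : Prop := OrthSubgroup {
  osub1 : A 1%g;
  osubM : forall g h, A g -> A h -> A (g * h)%g;
  osubV : forall g, A g -> A g^-1%g
}.

Variable e : nat -> H.
Hypothesis Qe : forall i, Q (e i) = if (i < p)%N then 1 else -1.
Hypothesis eorth : forall i j, i != j -> phi (e i) (e j) = 0.
Hypothesis eneg :
  forall x, (forall i, (i < p)%N -> phi (e i) x = 0) -> x != 0 -> Q x < 0.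

Variables G N : set (orth H).
Hypotheses (subG : orth_subgroup G) (subN : orth_subgroup N).
Hypothesis N_normal : forall g n, G g -> N n -> N (g * n * g^-1)%g.
Hypothesis G_qrefl : forall g, negative_qrefl g -> G g.

(** The closure of [A] for pointwise convergence on [H], where [H] is taken with
the discrete topology. *)
Definition orth_limit (A : set (orth H)) : set (orth H) :=
  [set g | forall s, exists n, A n /\ forall x, x \in s -> n x = g x].

Let M := orth_limit N.

Lemma orth_limit_subgroup : orth_subgroup M.
Proof.
split.
- by move=> s; exists 1%g; split=> //; exact: osub1.
- move=> g h Mg Mh s; have [n [Nn ng]] := Mg (map h s).
  have [n' [Nn' nh]] := Mh s; exists (n * n')%g; split; first exact: osubM.
  by move=> x xs; rewrite -[LHS]/(n (n' x)) nh // ng // map_f.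
- move=> g Mg s; have [n [Nn ng]] := Mg (map g^-1%g s).
  exists n^-1%g; split; first exact: osubV.
  move=> x xs; rewrite -[x in LHS](orthKV g) -ng ?map_f //.
  by rewrite orthVK.
Qed.

(** Pass through a vector [k] orthogonal to [x] and [y], as [x - k] and [k - y]
then have the negative square [2 * Q x]. *)
Lemma negative_transitive s x y : Q x < 0 -> Q x = Q y ->
  (forall z, z \in s -> phi z x = 0) -> (forall z, z \in s -> phi z y = 0) ->
  exists g, [/\ G g, g x = y & forall z, z \in s -> g z = z].
Proof.
move=> x0 xy sx sy.
have [k [Qk ks]] := negative_orth hK Qe eorth (x :: y :: s) x0.
have step z t : Q z = Q x -> Q t = Q x -> phi z t = 0 ->
    (forall r, r \in s -> phi r z = 0) -> (forall r, r \in s -> phi r t = 0) ->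
    exists g, [/\ G g, g z = t & forall r, r \in s -> g r = r].
  move=> Qz Qt zt sz st.
  have [||g [gneg gz gfix]] := negative_qrefl_move hK (x := z) (y := t).
  - by rewrite Qz.
  - by rewrite (QB hK) zt (sre0 hK) Qz Qt; lra.
  exists g; split=> [||r rs]; [exact: G_qrefl|by []|].
  by apply: gfix; apply: (phi_orthC); rewrite (hformBr hphi) sz ?st ?subrr.
have sk z : z \in s -> phi z k = 0 by move=> zs; rewrite ks // !inE zs !orbT.
have [//|//||//|//|g [Gg gx gs]] := step x k; first by rewrite ks ?mem_head.
have [//|//||//|//|h [Gh hk hs]] := step k y.
  by apply: phi_orthC; rewrite ks // !inE eqxx orbT.
exists (h * g)%g; split; first exact: osubM.
  by rewrite -[LHS]/(h (g x)) gx.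
by move=> z zs; rewrite -[LHS]/(h (g z)) gs // hs.
Qed.

(** That is, t_x / t_y lies in [N], where t_x is the quasi-reflection of vector
[x] and parameter [m]. *)
Definition qrefl_equiv m x y :=
  exists n, N n /\ forall z, n (qrefl y m z) = qrefl x m z.

Lemma qrefl_equiv_sym m x y : qrefl_equiv m x y -> qrefl_equiv m y x.
Proof.
move=> [n [Nn nE]]; exists n^-1%g; split=> [|z]; first exact: osubV.
by rewrite -nE orthVK.
Qed.

Lemma qrefl_equiv_trans m x y z :
  qrefl_equiv m x y -> qrefl_equiv m y z -> qrefl_equiv m x z.
Proof.
move=> [n [Nn nE]] [n' [Nn' n'E]]; exists (n * n')%g.
by split=> [|t]; [exact: osubM|rewrite -[LHS]/(n (n' _)) n'E].
Qed.

Lemma qrefl_equiv_conj m x y g :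
  G g -> qrefl_equiv m x y -> qrefl_equiv m (g x) (g y).
Proof.
move=> Gg [n [Nn nE]]; exists (g * n * g^-1)%g; split=> [|z].
  exact: N_normal.
rewrite -[z](orthKV g) -!(orth_qrefl hK) -nE.
by rewrite -[LHS]/(g (n (g^-1%g _))) orthVK.
Qed.

(** Conjugating the quasi-reflection of [v] by [n] gives that of [n v], so the
commutator of [n] with it is the required quotient. *)
Lemma qrefl_equiv_commutator m v n : Q v < 0 -> qrefl_param (Q v) m ->
  N n -> qrefl_equiv m (n v) v.
Proof.
move=> v0 vm Nn; have [t tE] := orth_of_qrefl hK vm.
have Gt : G t by apply: G_qrefl; exists v, m.
exists (n * (t * n^-1 * t^-1))%g; split=> [|z].
  by apply: osubM => //; apply: N_normal => //; exact: osubV.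
rewrite -tE -[LHS]/(n (t (n^-1%g (t^-1%g (t z))))) orthVK tE.
by rewrite (orth_qrefl hK) orthKV.
Qed.

(** Conjugating the commutator above by the isometry that exchanges a vector
with its twin makes two orthogonal vectors equivalent; by transitivity every [v]
is then equivalent to a vector orthogonal to the finite set [s], whose
quasi-reflection is the identity on [s]. *)
Lemma negative_qrefl_limit n0 g :
  N n0 -> ~ (exists a, central_unit a /\ forall x, n0 x = x *> a) ->
  negative_qrefl g -> M g.
Proof.
move=> Nn0 nscal [v [m [v0 vm gE]]] s.
have [u [Qu uN]] : exists u, Q u = Q v /\ forall a, n0 u <> u *> a.
  apply: contrapT => h; apply: nscal.
  apply: (negative_eigenvectors_scalar hK Qe eorth) => u u0.
  (* rescale u to the square of v *)
  pose r := Num.sqrt (Q v / Q u).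
  have vu0 : 0 < Q v / Q u by rewrite nmulr_rgt0 // invr_lt0.
  have r0 : r != 0 by rewrite gt_eqF // sqrtr_gt0.
  apply: contrapT => ueig; apply: h; exists (u *> of_real K r); split.
    by rewrite (QZr hK) sqr_sqrtr ?ltW // divfK // lt_eqF.
  move=> a; rewrite orthZ => /(congr1 (fun t => t *> of_real K r^-1)).
  rewrite !rscaleM -(of_realM hK) mulfV // (of_real1 hK) rscalar1 => eq.
  by apply: ueig; eexists; exact: eq.
have um : qrefl_param (Q u) m by rewrite Qu.
have u0 : Q u < 0 by rewrite Qu.
have [w [Qw uw nw]] := orthogonal_twin hK Qe eorth eneg p_gt0 u0 uN.
have equw : qrefl_equiv m u w.
  have nu := qrefl_equiv_commutator u0 um Nn0.
  apply: qrefl_equiv_trans (qrefl_equiv_sym nu) _.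
  have [||t [tneg tu tfix]] := negative_qrefl_move hK (x := u) (y := w).
  - by [].
  - by rewrite (QB hK) uw (sre0 hK) Qw; lra.
  have <- : t (n0 u) = n0 u.
    by apply/tfix/phi_orthC; rewrite (hformBr hphi) nw subrr.
  by rewrite -tu; apply: qrefl_equiv_conj nu; exact: G_qrefl.
have [//||//||g1 [Gg1 g1u _]] := @negative_transitive [::] u v => //.
have vw1 : phi v (g1 w) = 0 by rewrite -g1u (orth_phi hK).
have [k [Qk ks]] := negative_orth hK Qe eorth (v :: s) v0.
have [|||| g2 [Gg2 g2w g2v]] := @negative_transitive [:: v] (g1 w) k.
- by rewrite orthQ Qw.
- by rewrite orthQ Qw Qu.
- by move=> z; rewrite inE => /eqP->.
- by move=> z; rewrite inE => /eqP->; rewrite ks ?mem_head.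
have := qrefl_equiv_conj Gg2 (qrefl_equiv_conj Gg1 equw).
rewrite g1u g2w g2v ?mem_head // => -[n [Nn nE]].
exists n; split=> // x xs; rewrite gE -nE qrefl_orth //.
by apply: phi_orthC; rewrite ks // inE xs orbT.
Qed.

Hypothesis qrefl_limit : forall g, negative_qrefl g -> M g.

(** Pass through a vector [z] of square 1 whose products with [x] and with [y]
have real part above 1, as [x - z] and [z - y] are then negative. A large
multiple of [x + y] has such products; a negative vector orthogonal to
everything brings its square down to 1. *)
Lemma positive_move s x y : Q x = 1 -> Q y = 1 -> -1 < B x y ->
  (forall z, z \in s -> phi z x = 0) -> (forall z, z \in s -> phi z y = 0) ->
  exists g, [/\ M g, G g, g x = y & forall z, z \in s -> g z = z].
Proof.
move=> Qx Qy cgt sx sy; set c := B x y in cgt.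
have c1 : 0 < 1 + c by rewrite -ltrBlDl add0r.
(* z0 has product 3 + c with x and y, and its square exceeds 1 *)
pose r := 1 + 2 / (1 + c).
have rc : r * (1 + c) = 3 + c by rewrite /r; field; rewrite gt_eqF.
have r1 : 1 < r by rewrite /r ltrDl divr_gt0.
pose z0 := (x + y) *> of_real K r.
have Qz0 : Q z0 = 2 * (r * (3 + c)).
  by rewrite (QZr hK) (QD hK) Qx Qy -/c -rc; ring.
have Qz0gt : 1 < Q z0.
  have h : 2 < r * (3 + c).
    apply: lt_le_trans (_ : 3 + c <= _); first by lra.
    by rewrite ler_peMl // ?ltW //; lra.
  by rewrite Qz0; lra.
have [|k [Qk ks]] := negative_orth hK Qe eorth
  (x :: y :: z0 :: s) (q := 1 - Q z0).
  by rewrite subr_lt0.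
pose z := z0 + k.
have [xk yk zk] : [/\ phi x k = 0, phi y k = 0 & phi z0 k = 0].
  by split; apply: ks; rewrite !inE eqxx ?orbT.
have Qz : Q z = 1 by rewrite (QDorth hK) // Qk addrC subrK.
have Bxz : B x z = 3 + c.
  rewrite phiDr xk addr0 (sre_formZr hK hphi) phiDr (sreD hK) -/c -/(Q x) Qx.
  by rewrite rc.
have Byz : B y z = 3 + c.
  rewrite phiDr yk addr0 (sre_formZr hK hphi) phiDr (sreD hK) -/(Q y) Qy.
  by rewrite (BC hK x y) -/c [c + 1]addrC rc.
have sz t : t \in s -> phi t z = 0.
  move=> ts; rewrite phiDr phiZr phiDr sx // sy // addr0 mul0r add0r.
  by rewrite ks // !inE ts !orbT.
have [||g [gneg gx gfix]] := negative_qrefl_move hK (x := x) (y := z).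
- by rewrite Qx Qz.
- by rewrite (QB hK) Qx Qz Bxz; lra.
have [||h [hneg hz hfix]] := negative_qrefl_move hK (x := z) (y := y).
- by rewrite Qy Qz.
- by rewrite (QB hK) Qy Qz (BC hK y z) Byz; lra.
exists (h * g)%g; split.
- by apply: (osubM orth_limit_subgroup); exact: qrefl_limit.
- by apply: osubM => //; exact: G_qrefl.
- by rewrite -[LHS]/(h (g x)) gx.
- move=> t ts; rewrite -[LHS]/(h (g t)) gfix ?hfix //.
  + by apply: phi_orthC; rewrite (hformBr hphi) sz ?sy ?subrr.
  + by apply: phi_orthC; rewrite (hformBr hphi) sz ?sx ?subrr.
Qed.

(** The condition under which, the vectors [e 0], ..., [e i.-1] being already
fixed, the image of [e i] can be moved to [e i] by negative quasi-reflections
inside their orthogonal: at once, or through [u]. Over the reals this restricts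
[g], since negative reflections preserve the time orientation. *)
Hypothesis positive_room : forall g i, G g -> (i < p)%N ->
  (forall j, (j < i)%N -> g (e j) = e j) ->
  -1 < B (g (e i)) (e i) \/
  exists u, [/\ Q u = 1, forall j, (j < i)%N -> phi (e j) u = 0
                & B (g (e i)) u = 0].

Lemma fix_positive_basis g i : G g -> (i <= p)%N ->
  exists t, [/\ M t, G t & forall j, (j < i)%N -> t (g (e j)) = e j].
Proof.
move=> Gg; elim: i => [|i IH] ip.
  by exists 1%g; split=> //; [exact: osub1 orth_limit_subgroup|exact: osub1].
have [t [Mt Gt tfix]] := IH (ltnW ip).
pose s := [seq e j | j <- iota 0 i].
have sP z : z \in s -> exists2 j, (j < i)%N & z = e j.
  by move=> /mapP[j]; rewrite mem_iota add0n => ji ->; exists j.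
have Gtg : G (t * g)%g by exact: osubM.
set x := (t * g)%g (e i).
have Qei : Q (e i) = 1 by rewrite Qe ip.
have Qx : Q x = 1 by rewrite orthQ.
have se z : z \in s -> phi z (e i) = 0.
  by move=> /sP[j ji ->]; apply: eorth; rewrite neq_ltn ji.
have sx z : z \in s -> phi z x = 0.
  move=> /sP[j ji ->]; rewrite -[in LHS](tfix _ ji) -[t (g _)]/((t * g)%g _).
  by rewrite (orth_phi hK); apply: eorth; rewrite neq_ltn ji.
suff [h [Mh Gh hx hs]] : exists h,
    [/\ M h, G h, h x = e i & forall z, z \in s -> h z = z].
  exists (h * t)%g; split.
  - exact: osubM orth_limit_subgroup _ _ _ _.
  - exact: osubM.
  - move=> j; rewrite ltnS leq_eqVlt => /orP[/eqP->|ji]; first exact: hx.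
    rewrite -[LHS]/(h (t (g (e j)))) tfix // hs //.
    by apply/mapP; exists j; rewrite // mem_iota.
have [Bx|[u [Qu eu xu]]] := positive_room Gtg ip tfix.
  exact: positive_move.
(* both u and its opposite are suitable; take the one on the side of e i *)
wlog Bue : u Qu eu xu / 0 <= B u (e i) => [wl|].
  have [|neg] := leP 0 (B u (e i)); first exact: wl.
  apply: (wl (- u)).
  - by rewrite /Q (qformN hphi).
  - by move=> j ji; rewrite (hformNr hphi) eu ?oppr0.
  - by rewrite (hformNr hphi) (sreN hK) xu oppr0.
  - by rewrite (hformNl hphi) (sreN hK) oppr_ge0 ltW.
have su z : z \in s -> phi z u = 0 by move=> /sP[j ji ->]; exact: eu.
have [|g1 [Mg1 Gg1 g1x g1s]] := positive_move Qx Qu _ sx su.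
  by rewrite xu ltrN10.
have [|g2 [Mg2 Gg2 g2u g2s]] := positive_move Qu Qei _ su se.
  by apply: lt_le_trans Bue; rewrite ltrN10.
exists (g2 * g1)%g; split.
- exact: osubM orth_limit_subgroup _ _ _ _.
- exact: osubM.
- by rewrite -[LHS]/(g2 (g1 x)) g1x.
- by move=> z zs; rewrite -[LHS]/(g2 (g1 z)) g1s // g2s.
Qed.

(** Once the positive directions are fixed, the differences [t (g x) - x] lie
in their orthogonal, a negative definite space, so each of them is the vector of
a negative quasi-reflection. *)
Lemma fix_finite_set g s : G g -> (forall j, (j < p)%N -> g (e j) = e j) ->
  exists t, [/\ M t, forall j, (j < p)%N -> t (e j) = e j
    & forall x, x \in s -> t (g x) = x].
Proof.
move=> Gg ge; elim: s => [|x s [t [Mt te ts]]].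
  by exists 1%g; split=> //; exact: osub1 orth_limit_subgroup.
set y := t (g x).
have [yx|yx] := eqVneq y x.
  by exists t; split=> // z; rewrite inE => /orP[/eqP->//|]; exact: ts.
have fixed z : t (g z) = z -> phi (y - x) z = 0.
  move=> zE; rewrite (hformBl hphi) /y -[in X in X - _]zE !(orth_phi hK).
  by rewrite subrr.
have fixe j : (j < p)%N -> t (g (e j)) = e j by move=> jp; rewrite ge ?te.
have [||h [hneg hy hfix]] := negative_qrefl_move hK (x := y) (y := x).
- by rewrite !orthQ.
- apply: eneg; last by rewrite subr_eq0.
  by move=> i ip; apply: phi_orthC; exact: fixed (fixe _ ip).
exists (h * t)%g; split.
- by apply: osubM orth_limit_subgroup _ _ _ _ => //; exact: qrefl_limit.
- by move=> j jp; rewrite -[LHS]/(h (t _)) te // hfix // fixed // fixe.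
- move=> z; rewrite inE => /orP[/eqP->|zs]; first exact: hy.
  by rewrite -[LHS]/(h (t (g z))) ts // hfix // fixed // ts.
Qed.

Lemma subgroup_in_limit g : G g -> M g.
Proof.
move=> Gg s; have [t [Mt Gt te]] := fix_positive_basis Gg (leqnn p).
have [t' [Mt' _ t's]] := fix_finite_set s (osubM subG Gt Gg) te.
have Mi : M (t' * t)^-1%g.
  apply: osubV orth_limit_subgroup _ _.
  exact: osubM orth_limit_subgroup _ _ _ _.
have [n [Nn nE]] := Mi s; exists n; split=> // x xs; rewrite nE //.
by rewrite -[in LHS](t's _ xs) -[t' _]/((t' * t)%g (g x)) orthVK.
Qed.

End Density.

(** * Positive frames and time orientation *)

Lemma poly_sign_const (R : realType) (P : {poly R}) :
  (forall t, 0 <= t <= 1 -> P.[t] != 0) -> Num.sg P.[0] = Num.sg P.[1].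
Proof.
move=> P0.
have no_change (S : {poly R}) : (forall t, 0 <= t <= 1 -> S.[t] != 0) ->
    S.[0] <= 0 -> 0 <= S.[1] -> False.
  move=> S0 le0 ge1.
  have [|t t01 /rootP St] := @Num.Theory.poly_ivt R S 0 1 ler01.
    by rewrite le0.
  by have := S0 t t01; rewrite St eqxx.
rewrite -!neqr0_sign ?P0 ?lexx ?ler01 //; congr (_ ^+ _).
case: (ltP P.[0] 0) => h0; case: (ltP P.[1] 0) => h1 //; exfalso.
  by apply: (no_change P) => //; exact: ltW.
apply: (no_change (- P)) => [t t01||]; rewrite hornerN.
- by rewrite oppr_eq0 P0.
- by rewrite oppr_le0.
- by rewrite oppr_ge0 ltW.
Qed.

Section TimeOrientation.
Variables (R : realType) (p : nat) (H : qspace (realScalars R) p).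
Implicit Types (x y z : H) (c : 'I_p -> R) (g h : orth H).

Let hK := real_scalar_laws R.
Let hphi := phi_hermitian H.
Let B x y : R := sre (phi x y).
Let frame := 'I_p -> H.
Implicit Types (u v w : frame).

Let comb v c : H := \sum_i rscale (K := realScalars R) (v i) (c i).

Let B_combl v c x : B (comb v c) x = \sum_i c i * B (v i) x.
Proof.
rewrite /B (hform_suml hphi) (sre_sum hK); apply: eq_bigr => i _.
by rewrite (hformZl hphi).
Qed.

Let B_combr v c x : B x (comb v c) = \sum_i B x (v i) * c i.
Proof.
rewrite /B (hform_sumr hphi) (sre_sum hK); apply: eq_bigr => i _.
by rewrite phiZr.
Qed.

Let BDl x y z : B (x + y) z = B x z + B y z.
Proof. by rewrite /B (hformDl hphi). Qed.
Let Bsym x y : B y x = B x y. Proof. exact: BC. Qed.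
Let Bphi x y : B x y = 0 -> phi x y = 0. Proof. by []. Qed.
Let B_orth g x y : B (g x) (g y) = B x y.
Proof. by rewrite /B (orth_phi hK). Qed.

Definition positive_frame v :=
  forall c, (exists i, c i != 0) -> 0 < Q (comb v c).

Definition gram v w : 'M[R]_p := \matrix_(i, j) sre (phi (v i) (w j)).

Lemma gram_tr v w : gram w v = (gram v w)^T.
Proof. by apply/matrixP => i j; rewrite !mxE -[LHS]/(B _ _) Bsym. Qed.

Lemma gram_orth g v w : gram (g \o v) (g \o w) = gram v w.
Proof. by apply/matrixP => i j; rewrite !mxE -[LHS]/(B _ _) B_orth. Qed.

Let row_gram v w (c : 'rV[R]_p) j :
  (c *m gram v w) 0 j = B (comb v (c 0)) (w j).
Proof. by rewrite B_combl mxE; apply: eq_bigr => i _; rewrite mxE. Qed.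

Let gram_col v w (d : 'cV[R]_p) i :
  (gram v w *m d) i 0 = B (v i) (comb w (d^~ 0)).
Proof. by rewrite B_combr mxE; apply: eq_bigr => j _; rewrite mxE. Qed.

Variable e : nat -> H.
Hypothesis Qe : forall i, Q (e i) = if (i < p)%N then 1 else -1.
Hypothesis eorth : forall i j, i != j -> phi (e i) (e j) = 0.
Hypothesis eneg :
  forall x, (forall i, (i < p)%N -> phi (e i) x = 0) -> x != 0 -> Q x < 0.

Let e0 : frame := fun i => e i.

Let e_nonpos x : (forall i, B x (e0 i) = 0) -> Q x <= 0.
Proof.
move=> xe; have [->|x0] := eqVneq x 0; first by rewrite Q0.
apply/ltW/eneg => // i ip; apply: phi_orthC.
exact: (Bphi (xe (Ordinal ip))).
Qed.

Lemma gram_std : gram e0 e0 = 1%:M.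
Proof.
apply/matrixP => i j; rewrite !mxE; have [->|ij] := eqVneq i j.
  by rewrite -[LHS]/(Q _) Qe ltn_ord.
by rewrite (eorth ij).
Qed.

Let row_eq0 (c : 'rV[R]_p) : c != 0 -> exists i, c 0 i != 0.
Proof. by move=> /rV0Pn. Qed.

(** Otherwise [w] and [x] would span a positive definite space of dimension
[p.+1], and some vector of it would be orthogonal to [e 0], ..., [e p.-1]. *)
Lemma orth_positive_frame_nonpos w x :
  positive_frame w -> (forall j, phi x (w j) = 0) -> Q x <= 0.
Proof.
move=> wpos xw.
have wU : gram w e0 \in unitmx.
  rewrite unitmxE unitfE; apply/det0P => -[c /row_eq0/wpos c0 cw].
  suff : Q (comb w (c 0)) <= 0 by rewrite leNgt c0.
  by apply: e_nonpos => j; rewrite -row_gram cw mxE.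
pose d : 'rV[R]_p := - (\row_j B x (e0 j)) *m invmx (gram w e0).
rewrite leNgt; apply/negP => Qx.
have dx : B (comb w (d 0)) x = 0.
  rewrite B_combl big1 // => i _.
  by rewrite Bsym /B xw (sre0 hK) mulr0.
have : Q (comb w (d 0) + x) <= 0.
  apply: e_nonpos => j; rewrite BDl -row_gram mulmxKV // !mxE.
  by rewrite addNr.
rewrite (QDorth hK) // leNgt => /negP; apply.
have [d0|/row_eq0/wpos d0] := eqVneq d 0; last exact: addr_gt0.
by rewrite d0 /comb big1 ?Q0 ?add0r // => i _; rewrite mxE rscale0.
Qed.

Lemma gram_det_neq0 v w : positive_frame v -> positive_frame w ->
  \det (gram v w) != 0.
Proof.
move=> vpos wpos; apply/det0P => -[c /row_eq0/vpos c0 cw].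
suff : Q (comb v (c 0)) <= 0 by rewrite leNgt c0.
apply: (orth_positive_frame_nonpos wpos) => j.
by apply: Bphi; rewrite -row_gram cw mxE.
Qed.

Let sign v w : R := Num.sg (\det (gram v w)).

(** Split [v] as [v1 + v2] along the span of [w] and its orthogonal; the frames
[v1 + t * v2] for [t] in the unit interval are positive, so that their Gram
determinant with [u] keeps a constant sign. At [t = 0] the frame is the image of
[w] by the matrix [gram v w * (gram w w)^-1]. *)
Lemma sign_cocycle v w u :
  positive_frame v -> positive_frame w -> positive_frame u ->
  sign v u = sign v w * sign w w * sign w u.
Proof.
move=> vpos wpos upos.
pose A := gram v w *m invmx (gram w w).
have wwU : gram w w \in unitmx by rewrite unitmxE unitfE gram_det_neq0.
have Aw : A *m gram w w = gram v w by rewrite mulmxKV.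
pose v1 i := comb w (A i); pose v2 i := v i - v1 i.
have v2w i j : B (v2 i) (w j) = 0.
  rewrite /v2 /B (hformBl hphi) (sreB hK) -!/(B _ _).
  apply/eqP; rewrite subr_eq0 B_combl; apply/eqP.
  have <- : (A *m gram w w) i j = B (v i) (w j) by rewrite Aw mxE.
  by rewrite mxE; apply: eq_bigr => k _; rewrite [gram w w k j]mxE.
have v2v1 i k : B (v2 i) (v1 k) = 0.
  by rewrite B_combr big1 // => j _; rewrite v2w mul0r.
have v1u : gram v1 u = A *m gram w u.
  apply/matrixP => i j; rewrite !mxE -[LHS]/(B _ _) B_combl.
  by apply: eq_bigr => k _; rewrite [gram w u k j]mxE.
pose vt t i := v1 i + rscale (K := realScalars R) (v2 i) t.
have combt t c : comb (vt t) c = comb v1 c +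
    rscale (K := realScalars R) (comb v2 c) t.
  rewrite /comb rscale_suml -big_split /=; apply: eq_bigr => i _.
  by rewrite /vt rscaleDr !rscaleM [t * _]mulrC.
have comb12 c : B (comb v1 c) (comb v2 c) = 0.
  rewrite B_combl big1 // => i _; rewrite B_combr big1 ?mulr0 // => j _.
  by rewrite Bsym v2v1 mul0r.
have Qt t c : Q (comb (vt t) c) = Q (comb v1 c) + t ^+ 2 * Q (comb v2 c).
  rewrite combt (QDorth hK) ?(QZ hK) //.
  by rewrite phiZr (Bphi (comb12 c)) mul0r.
have vt1 : vt 1 = v.
  by apply/funext => i; rewrite /vt rscalar1 /v2 addrC subrK.
have vtpos t : 0 <= t <= 1 -> positive_frame (vt t).
  move=> /andP[t0 t1] c /vpos; rewrite -{1}vt1 !Qt expr1n mul1r => h.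
  apply: lt_le_trans h _; rewrite lerD2l.
  have Q2 : Q (comb v2 c) <= 0.
    apply: (orth_positive_frame_nonpos wpos) => j; apply: Bphi.
    by rewrite B_combl big1 // => i _; rewrite v2w mulr0.
  by rewrite ler_niMl // expr_le1.
pose P : {poly R} :=
  \det (map_mx polyC (gram v1 u) + 'X *: map_mx polyC (gram v2 u)).
have PE t : P.[t] = \det (gram (vt t) u).
  rewrite /P -horner_evalE -det_map_mx; congr (\det _).
  apply/matrixP => i j; rewrite !mxE /= /horner_eval.
  rewrite hornerD hornerM hornerX !hornerC.
  by rewrite -[RHS]/(B (vt t i) (u j)) /vt BDl /B (hformZl hphi).
have vt0 : vt 0 = v1 by apply/funext => i; rewrite /vt rscale0 addr0.
have := poly_sign_const (P := P); rewrite !PE vt0 vt1 => h.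
rewrite /sign -h => [|t /vtpos vtp]; last by rewrite PE gram_det_neq0.
rewrite v1u -Aw !det_mulmx !sgrM -!mulrA; do 2 congr (_ * _).
by rewrite mulrA -expr2 sqr_sg gram_det_neq0 // mul1r.
Qed.

Lemma std_positive : positive_frame e0.
Proof.
move=> c [i ci]; rewrite /Q /comb (qform_sum_orth hK hphi).
  rewrite (bigD1 i) // ltr_wpDr //; last first.
    rewrite -/(Q _) (QZ hK) Qe ltn_ord mulr1.
    exact: (sabs2_gt0 hK).
  apply: sumr_ge0 => j _; rewrite -/(Q _) (QZ hK) Qe ltn_ord mulr1.
  exact: (sabs2_ge0 hK).
by move=> j k jk; rewrite (hformZl hphi) phiZr (eorth jk) mul0r mulr0.
Qed.

(** By the cocycle relation from [e0] to [e0] through [w], this sign is the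
inverse of a nonzero square. *)
Lemma sign_diag w : positive_frame w -> sign w w = 1.
Proof.
move=> wpos; have := sign_cocycle std_positive wpos std_positive.
rewrite /sign gram_std det1 sgr1 [gram w e0]gram_tr det_tr mulrAC -expr2.
by rewrite sqr_sg gram_det_neq0 ?mul1r //; exact: std_positive.
Qed.

Lemma signC v w : sign w v = sign v w.
Proof. by rewrite /sign gram_tr det_tr. Qed.

Lemma sign_orth g v w : sign (g \o v) (g \o w) = sign v w.
Proof. by rewrite /sign gram_orth. Qed.

Lemma sign_sqr v w : positive_frame v -> positive_frame w ->
  sign v w * sign v w = 1.
Proof. by move=> vpos wpos; rewrite -expr2 sqr_sg gram_det_neq0. Qed.

Lemma signM v w u :
  positive_frame v -> positive_frame w -> positive_frame u ->
  sign v u = sign v w * sign w u.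
Proof.
by move=> vpos wpos upos; rewrite (sign_cocycle vpos wpos) // sign_diag ?mulr1.
Qed.

Lemma positive_frame_orth g v : positive_frame v -> positive_frame (g \o v).
Proof.
move=> vpos c /vpos c0.
rewrite (_ : comb _ c = g (comb v c)) ?orthQ //.
by rewrite orth_sum; apply: eq_bigr => i _; rewrite orthZ.
Qed.

(** Going from [w] to [g w] through [v] and [g v], the first and the last sign
agree and cancel. *)
Lemma sign_orth_indep g v w : positive_frame v -> positive_frame w ->
  sign w (g \o w) = sign v (g \o v).
Proof.
move=> vpos wpos.
have gv := positive_frame_orth g vpos; have gw := positive_frame_orth g wpos.
rewrite (signM wpos vpos gw) (signM vpos gv gw) mulrCA.
by rewrite sign_orth (signC v w) sign_sqr ?mulr1.
Qed.

Lemma basis_positive_frame (V : symspace H) b :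
  is_basis b V -> positive_frame b.
Proof.
move=> [bfree bV] c [i ci]; have [_ Vpos] := symspaceP V.
apply: Vpos; first by rewrite bV; exists c.
by apply: contraNneq ci => /bfree->.
Qed.

(** The columns of the compression are the coordinates of the projections of
the [g (b j)], which have the same products with the [b i] as the [g (b j)]. *)
Lemma gram_compression g (V : symspace H) b : is_basis b V ->
  gram b b *m compression_mx g V b = gram b (g \o b).
Proof.
move=> bV; have bpos := basis_positive_frame bV; have [_ VE] := bV.
have bbU : gram b b \in unitmx by rewrite unitmxE unitfE gram_det_neq0.
set VS : set H := symspace_set V in VE *.
have projP x : VS (qproj VS x) /\ forall z, VS z -> phi z (x - qproj VS x) = 0.
  apply: (@xgetPex H 0
    [set y | VS y /\ forall z, VS z -> phi z (x - y) = 0]).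
  pose a := invmx (gram b b) *m (\col_i B (b i) x).
  exists (comb b (a^~ 0)); rewrite VE; split=> [|z [d ->]].
    by exists (a^~ 0).
  apply: Bphi; rewrite -/(comb b d) B_combl big1 // => i _.
  rewrite /B (hformBr hphi) (sreB hK) -!/(B _ _) -gram_col.
  by rewrite mulKVmx // mxE subrr mulr0.
have coordsP y : VS y -> y = comb b (coords b y).
  rewrite {1}VE => -[d dE].
  apply: (@xgetPex _ (fun=> 0) [set a | y = comb b a]).
  by exists d.
apply/matrixP => i j; rewrite mxE [RHS]mxE.
have [Vy yP] := projP (g (b j)).
have qE : B (b i) (g (b j)) = B (b i) (qproj VS (g (b j))).
  have : phi (b i) (g (b j) - qproj VS (g (b j))) = 0.
    apply: yP; rewrite VE; exists (fun k => (k == i)%:R).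
    rewrite (bigD1 i) //= eqxx big1 ?addr0 => [|k /negbTE ->].
      by rewrite rscalar1.
    by rewrite rscale0.
  by rewrite (hformBr hphi) => /subr0_eq; rewrite /B => ->.
rewrite -[RHS]/(B (b i) (g (b j))) qE [in RHS](coordsP _ Vy) B_combr.
apply: eq_bigr => k _.
by rewrite !mxE.
Qed.

Lemma orthochronousP g : orthochronous H g <-> sign e0 (g \o e0) = 1.
Proof.
have sgE (V : symspace H) b : is_basis b V ->
    Num.sg (\det (compression_mx g V b)) = sign b (g \o b).
  move=> bV; rewrite /sign -(gram_compression g bV) det_mulmx sgrM.
  by rewrite -/(sign _ _) sign_diag ?mul1r //; exact: basis_positive_frame bV.
split=> [gP|ge V b bV].
  pose V := [set x | exists c : 'I_p -> realScalars R, x = \sum_i e0 i *> c i].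
  have Vb : is_basis e0 V.
    split=> // c ce i; apply/eqP/negPn/negP => ci.
    by have := std_positive (ex_intro _ i ci); rewrite /comb ce Q0 // ltxx.
  have VP : (exists b, is_basis b V) /\ is_positive V.
    split; first by exists e0.
    move=> x [c ->] x0; apply: std_positive; apply: contrapT => h.
    move/eqP: x0; apply; rewrite big1 // => i _.
    have [->|ci] := eqVneq (c i) 0; first by rewrite rscale0.
    by case: h; exists i.
  by rewrite -(sgE (SymSpace VP)) // gP.
rewrite sgE // (sign_orth_indep _ std_positive) //.
exact: basis_positive_frame bV.
Qed.

Lemma orthochronous_subgroup : orth_subgroup (orthochronous H).
Proof.
have pos := std_positive.
split.
- by apply/orthochronousP; exact: sign_diag.
- move=> g h /orthochronousP ge /orthochronousP he; apply/orthochronousP.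
  rewrite (signM pos (positive_frame_orth g pos) (positive_frame_orth _ pos)).
  by rewrite ge mul1r; exact: etrans (sign_orth g e0 (h \o e0)) he.
- move=> g /orthochronousP ge; apply/orthochronousP; rewrite -ge signC.
  rewrite /sign -(gram_orth g); congr (Num.sg (\det (gram _ _))).
  by apply/funext => i; exact: orthKV.
Qed.

(** The sign can be computed on a positive frame orthogonal to the vector of
the reflection, which is fixed by it. *)
Lemma orthochronous_negative_qrefl g : negative_qrefl g -> orthochronous H g.
Proof.
move=> [v [m [v0 vm gE]]]; have vN0 : Q v != 0 by rewrite lt_eqF.
pose b : frame := fun i => ortho_proj v (e i).
have bpos : positive_frame b.
  move=> c /std_positive c0.
  have -> : comb b c = ortho_proj v (comb e0 c).
    rewrite /ortho_proj /comb (hform_sumr hphi) mulr_sumr rscale_sumr -sumrB.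
    apply: eq_bigr => i _.
    by rewrite rscaleDr rscaleNl rscaleM phiZr mulrA.
  rewrite (Q_ortho_proj hK) //; apply: lt_le_trans c0 _.
  by rewrite lerDl oppr_ge0 mulr_le0_ge0 ?(sabs2_ge0 hK) // invr_le0 ltW.
apply/orthochronousP; rewrite (sign_orth_indep _ bpos std_positive).
have -> : g \o b = b.
  apply/funext => i /=; rewrite gE qrefl_orth //.
  by rewrite (phi_ortho_proj hK).
exact: sign_diag.
Qed.

(** As long as a second positive direction [e i.+1] remains, a vector of the
plane of [e i] and [e i.+1] is orthogonal to [g (e i)]. When [i] is the last
index the Gram matrix is triangular with all diagonal entries but the last equal
to 1, so the last one has the sign of the determinant. *)
Lemma orthochronous_positive_room g i : orthochronous H g -> (i < p)%N ->
  (forall j, (j < i)%N -> g (e j) = e j) ->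
  -1 < B (g (e i)) (e i) \/
  exists x, [/\ Q x = 1, forall j, (j < i)%N -> phi (e j) x = 0
                & B (g (e i)) x = 0].
Proof.
move=> /orthochronousP gP ip ge.
have [i1p|i1p] := ltnP i.+1 p.
  right.
  have ne : i != i.+1 by rewrite neq_ltn ltnSn.
  have [|a [b [xab Qab]]] :=
      unit_combination_orth hK hphi (g (e i)) (eorth ne).
    by rewrite -/(Q _) -/(Q _) !Qe ip i1p.
  exists (e i *> a + e i.+1 *> b); split.
  - by rewrite /Q Qab -/(Q _) Qe ip.
  - move=> j ji; rewrite phiDr !phiZr !eorth ?mul0r ?addr0 //.
      by rewrite neq_ltn ltnS ltnW.
    by rewrite neq_ltn ji.
  - by rewrite /B xab.
left; apply: lt_trans (ltrN10 R) _.
have pE : p = i.+1 by apply/eqP; rewrite eqn_leq ip i1p.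
have lt_last (k : 'I_p) : k != Ordinal ip -> (k < i)%N.
  by rewrite -val_eqE /= ltn_neqAle => -> /=; rewrite -ltnS -pE.
have trig : is_trig_mx (gram e0 (g \o e0)).
  apply/is_trig_mxP => a b ab; rewrite mxE /= /e0.
  have ai : (a < i)%N by apply: leq_trans ab _; rewrite -ltnS -pE.
  by rewrite -(ge _ ai) (orth_phi hK) eorth ?(sre0 hK) // neq_ltn ab.
move: gP; rewrite /sign det_trig // (bigD1 (Ordinal ip)) //= big1.
  by rewrite mulr1 mxE /= => /eqP; rewrite sgr_cp0 Bsym.
move=> k /lt_last ki; rewrite mxE -[LHS]/(B (e k) (g (e k))) ge //.
by rewrite -[LHS]/(Q _) Qe ltn_ord.
Qed.

End TimeOrientation.

(** * From agreement on finite sets to density *)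

Lemma cvg_initial_topology (S : choiceType) (T : topologicalType) (f : S -> T)
    (F : set_system S) (x : S) : Filter F ->
  f @ F --> f x -> F --> (x : initial_topology f).
Proof.
move=> FF fF U; rewrite nbhsE => -[B [[C oC <-] Cx] CU].
by apply: filterS CU _; apply: fF; exact: open_nbhs_nbhs.
Qed.

Section Topology.
Variables (R : realType) (K : scalars R) (p : nat) (H : qspace K p).
Implicit Types (g n : orth H) (s : seq H) (V : symspace H).

Lemma symspace_ext (V W : symspace H) : (V : set H) = W -> V = W.
Proof.
case: V W => [V VP] [W WP] /= VW; case: _ / VW in WP *.
by congr SymSpace; exact: Prop_irrelevance.
Qed.

Lemma PO_act_pi g V : PO_act (\pi_(PO H) g) V = orth_act g V.
Proof.
rewrite /PO_act; have /eqP/PO_eqP[a [ua ga]] := reprK (\pi_(PO H) g).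
have [[b [_ VE]] _] := symspaceP V.
have VZ x (c : K) : (V : set H) x -> (V : set H) (x *> c).
  rewrite VE => -[d ->]; exists (fun i => d i * c).
  by rewrite rscale_suml; apply: eq_bigr => i _; rewrite rscaleM.
apply: symspace_ext; apply/seteqP; split=> _ [x Vx <-].
  by exists (x *> a); [exact: VZ|rewrite orthZ ga].
exists (x *> sconj a); first exact: VZ.
by rewrite ga orthZ rscaleM; have [ca ->] := ua; rewrite rscalar1.
Qed.

Lemma orth_act_agree g n V (b : 'I_p -> H) : is_basis b V ->
  (forall i, n (b i) = g (b i)) -> orth_act n V = orth_act g V.
Proof.
move=> [_ VE] ng; apply: symspace_ext.
have same x : (V : set H) x -> n x = g x.
  rewrite VE => -[c ->]; rewrite !orth_sum; apply: eq_bigr => i _.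
  by rewrite !orthZ ng.
by apply/seteqP; split=> _ [x Vx <-]; exists x => //; rewrite same.
Qed.

(** The elements of [A] agreeing with [g] on larger and larger finite sets form
a filter base, along which the image of each subspace is eventually constant. *)
Lemma orth_limit_closure (A : set (orth H)) g : orth_limit A g ->
  closure [set \pi_(PO H) n | n in A] (\pi_(PO H) g).
Proof.
move=> gA.
pose base s : set (PO H) :=
  [set \pi_(PO H) n | n in [set n | A n /\ forall x, x \in s -> n x = g x]].
pose F := filter_from setT base.
have FF : ProperFilter F.
  apply: filter_from_proper => [|s _]; last first.
    by have [n nP] := gA s; exists (\pi_(PO H) n), n.
  apply: filter_from_filter; first by exists [::].
  move=> s t _ _; exists (s ++ t) => // _ [n [An nst] <-].
  by split; exists n => //; split=> // x xs; apply: nst;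
    rewrite mem_cat xs ?orbT.
rewrite closureEcvg; exists F => //; split; last first.
  move=> B AB; exists [::] => // _ [n [An _] <-]; apply: AB; exists n => //.
have FF' : Filter F by case: FF.
pose act := @PO_act R K p H; pose x := \pi_(PO H) g.
suff : act @ F --> act x.
  by move=> h; exact: (@cvg_initial_topology _ _ act F x FF' h).
apply/cvg_sup => V.
suff : (fun f => f V) @ (act @ F) --> act x V.
  exact: (cvg_initial_topology (fmap_filter _ FF')).
apply: cvg_near_cst.
have [[b bV] _] := symspaceP V.
exists (codom b) => // _ [n [_ ng] <-] /=.
rewrite /act /x !PO_act_pi; apply: (orth_act_agree bV) => i.
by apply: ng; exact: codom_f.
Qed.

End Topology.

(** * Topological simplicity *)

Section Simplicity.
Variables (R : realType) (K : scalars R) (p : nat) (H : qspace K p).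
Hypotheses (hK : scalar_laws K) (p_gt0 : (0 < p)%N).
Implicit Types (g n : orth H).

Variable e : nat -> H.
Hypothesis Qe : forall i, Q (e i) = if (i < p)%N then 1 else -1.
Hypothesis eorth : forall i j, i != j -> phi (e i) (e j) = 0.
Hypothesis eneg :
  forall x, (forall i, (i < p)%N -> phi (e i) x = 0) -> x != 0 -> Q x < 0.

(** The lift to isometries of a normal subgroup [N] is a normal subgroup, and it
contains a nonscalar element as soon as [N] is not trivial. *)
Lemma topologically_simple_image (G : set (orth H)) :
  orth_subgroup G -> (forall g, negative_qrefl g -> G g) ->
  (forall g i, G g -> (i < p)%N -> (forall j, (j < i)%N -> g (e j) = e j) ->
    -1 < sre (phi (g (e i)) (e i)) \/
    exists u, [/\ Q u = 1, forall j, (j < i)%N -> phi (e j) u = 0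
                  & sre (phi (g (e i)) u) = 0]) ->
  topologically_simple [set \pi_(PO H) g | g in G].
Proof.
move=> subG Gqrefl room N [[N1 NB] NG Nconj] N_neq1 _ [g Gg <-].
pose L : set (orth H) := [set n | G n /\ N (\pi_(PO H) n)].
have NV x : N x -> N x^-1%g by move=> Nx; rewrite -[x^-1%g]mul1g; exact: NB.
have subL : orth_subgroup L.
  split.
  - by split; [exact: osub1|exact: N1].
  - move=> h k [Gh Nh] [Gk Nk]; split; first exact: osubM.
    by rewrite -PO_mulE -[\pi_(PO H) k]invgK; apply: NB => //; exact: NV.
  - move=> h [Gh Nh]; split; first exact: osubV.
    by rewrite -PO_invE; exact: NV.
have L_normal h n : G h -> L n -> L (h * n * h^-1)%g.
  move=> Gh [Gn Nn]; split; first by do 2?apply: osubM => //; exact: osubV.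
  have := Nconj (\pi_(PO H) h^-1%g) (\pi_(PO H) n) _ Nn.
  rewrite -PO_invE /conjg invgK mulgA -!PO_mulE -PO_invE; apply.
  by rewrite PO_invE; exists h^-1%g => //; exact: osubV.
have [n0 [Ln0 n0scal]] : exists n, L n /\
    ~ exists a : K, central_unit a /\ forall x, n x = x *> a.
  apply: contrapT => no; apply: N_neq1; apply/seteqP; split=> [y Ny|_ ->//].
  have [n Gn nE] := NG _ Ny; rewrite -nE in Ny *.
  have [a [ua na]] : exists a : K, central_unit a /\ forall x, n x = x *> a.
    by apply: contrapT => h; apply: no; exists n.
  by apply/eqP/PO_eqP; exists a.
have qlim h := negative_qrefl_limit hK p_gt0 Qe eorth eneg subG subL L_normal
  Gqrefl Ln0 n0scal (g := h).
have := orth_limit_closure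
  (subgroup_in_limit hK Qe eorth eneg subG subL Gqrefl qlim room Gg).
by apply: closureS => _ [n [_ Nn] <-].
Qed.

(** With an imaginary unit at hand, [g (e i)] times this unit is orthogonal, in
the real sense, to [g (e i)]. *)
Lemma topologically_simple_imaginary (j : K) :
  sconj j * j = 1 -> sre j = 0 -> topologically_simple [set: PO H].
Proof.
move=> j1 j0.
have -> : [set: PO H] = [set \pi_(PO H) g | g in setT].
  apply/seteqP; split=> // x _; exists (repr x) => //; exact: reprK.
apply: topologically_simple_image => //.
move=> g i _ ip ge; right; exists (g (e i) *> j); split.
- rewrite (QZ hK) orthQ Qe ip mulr1 /sabs2 j1.
  by rewrite -(of_real1 hK) (sre_real hK).
- move=> k ki; rewrite phiZr -(ge _ ki) (orth_phi hK) eorth ?mul0r //.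
  by rewrite neq_ltn ki.
- rewrite phiZr (orth_phi hK) (phi_diag hK) Qe ip (of_real1 hK) mul1r.
  exact: j0.
Qed.

End Simplicity.

Theorem theorem1p4 (R : realType) (p : nat) (hp : (1 <= p)%N) :
  (forall H : qspace (complexScalars R) p, topologically_simple [set: PO H]) /\
  (forall H : qspace (quaternionScalars R) p, topologically_simple [set: PO H]) /\
  (forall H : qspace (realScalars R) p, topologically_simple (POo H)).
Proof.
split; [|split] => H.
- have hK := complex_scalar_laws R.
  have [e [Qe eorth eneg]] := signature_basis H hK.
  apply: (topologically_simple_imaginary hK hp Qe eorth eneg
    (j := (Complex 0 1 : complexScalars R))) => //.
  by congr Complex => /=; ring.
- have hK := quaternion_scalar_laws R.
  have [e [Qe eorth eneg]] := signature_basis H hK.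
  apply: (topologically_simple_imaginary hK hp Qe eorth eneg
    (j := (Quat 0 1 0 0 : quaternionScalars R))) => //.
  by congr Quat => /=; ring.
- have hK := real_scalar_laws R.
  have [e [Qe eorth eneg]] := signature_basis H hK.
  apply: (topologically_simple_image hK hp Qe eorth eneg).
  + exact: orthochronous_subgroup Qe eorth eneg.
  + exact: orthochronous_negative_qrefl Qe eorth eneg.
  + exact: orthochronous_positive_room Qe eorth eneg.
Qed.
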